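(* Let $P_t$ evolve by the Fokker--Planck equation $\partial_tP_t=-\nabla\cdot(\boldsymbol\nu_tP_t)$ on $\mathbb R^d$ with mean local velocity $\boldsymbol\nu_t=\mu(\boldsymbol F_t-T\nabla\ln P_t)$. Let $\phi_\tau(\boldsymbol x)\in\mathbb R$ be the potential that satisfies $$\partial_\tau P_\tau(\boldsymbol x)=-\nabla\cdot(\boldsymbol\nu_\tau(\boldsymbol x)P_\tau(\boldsymbol x))=-\nabla\cdot(\boldsymbol\nu^*_\tau(\boldsymbol x)P_\tau(\boldsymbol x)),\qquad \boldsymbol\nu^*_\tau(\boldsymbol x)=\nabla\phi_\tau(\boldsymbol x).$$ Assume that $P_\tau(\boldsymbol x)$ decays sufficiently rapidly at infinity. Then the excess entropy production rate is $$\sigma^{\rm ex}_\tau=\frac1{\mu T}\int d\boldsymbol x\,\|\boldsymbol\nu^*_\tau(\boldsymbol x)\|^2P_\tau(\boldsymbol x),$$ and the housekeeping entropy production rate is $$\sigma^{\rm hk}_\tau=\frac1{\mu T}\int d\boldsymbol x\,\|\boldsymbol\nu_\tau(\boldsymbol x)-\boldsymbol\nu^*_\tau(\boldsymbol x)\|^2P_\tau(\boldsymbol x).$$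
   Context: $\mu>0$, $T>0$ are constants, $\boldsymbol F_t:\mathbb R^d\to\mathbb R^d$ is a force field, $P_t$ is a probability density on $\mathbb R^d$ with finite second moment. The entropy production rate is $\sigma_\tau=\frac1{\mu T}\int d\boldsymbol x\,\|\boldsymbol\nu_\tau(\boldsymbol x)\|^2P_\tau(\boldsymbol x)$. The $L^2$-Wasserstein distance between densities $P,Q$ with finite second moments is $$\mathcal W_2(P,Q)=\sqrt{\inf\ \Delta\tau\int_\tau^{\tau+\Delta\tau}dt\int d\boldsymbol x\,\|\boldsymbol v_t(\boldsymbol x)\|^2\mathcal P_t(\boldsymbol x)},$$ the infimum being over all paths $(\boldsymbol v_t,\mathcal P_t)_{\tau\le t\le\tau+\Delta\tau}$ with $\partial_t\mathcal P_t=-\nabla\cdot(\boldsymbol v_t\mathcal P_t)$, $\mathcal P_\tau=P$, $\mathcal P_{\tau+\Delta\tau}=Q$ (equivalently, the usual Monge--Kantorovich $L^2$ distance). The excess and housekeeping entropy production rates are defined by $$\sigma^{\rm ex}_\tau=\frac1{\mu T}\lim_{\Delta t\to0}\frac{[\mathcal W_2(P_\tau,P_{\tau+\Delta t})]^2}{(\Delta t)^2},\qquad \sigma^{\rm hk}_\tau=\sigma_\tau-\sigma^{\rm ex}_\tau.$$ ''Decays sufficiently rapidly at infinity'' means that boundary terms at infinity in integrations by parts against $P_\tau$ vanish, in particular $\int d\boldsymbol x\,\nabla\cdot[\phi_\tau(\boldsymbol\nu_\tau-\boldsymbol\nu^*_\tau)P_\tau]=0$. Functions are taken regular enough that all displayed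 expressions are defined.
   Formalization: Regularity is made explicit near τ: P>0, P and φ are C² and F is C¹ in x, ∂_tP and ∇φ are jointly continuous in (t,x), σ_τ is finite, and ∫‖ν*_t‖²P_t is continuous in t at τ; without the last, kinetic energy escaping to infinity can break the formula. *)

(* Defs.v *)
From HB Require Import structures.
From mathcomp Require Import all_boot all_order all_algebra.
From mathcomp Require Import all_classical all_reals all_analysis.

Set Implicit Arguments.
Unset Strict Implicit.
Unset Printing Implicit Defensive.

Import Order.TTheory GRing.Theory Num.Theory.
Import numFieldNormedType.Exports.

Local Open Scope classical_set_scope.
Local Open Scope ring_scope.

(* R^d is 'rV[R]_d. The library norm on 'rV[R]_d is the sup norm, so the
   Euclidean structure is given by dotmul and sqnorm below. *)

Definition rV_display : measure_display.
Proof. exact. Qed.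

(* Product sigma-algebra on R^d, built as the library does for n.-tuple. *)
Section rV_measurable.
Context {R : realType} {d : nat}.

Let coors : 'I_d -> 'rV[R]_d -> R := fun i x => x ord0 i.

Let rV_set0 : g_sigma_preimage coors set0.
Proof. exact: sigma_algebra0. Qed.

Let rV_setC A : g_sigma_preimage coors A -> g_sigma_preimage coors (~` A).
Proof. exact: sigma_algebraC. Qed.

Let rV_bigcup (F : (set 'rV[R]_d)^nat) :
  (forall i, g_sigma_preimage coors (F i)) ->
  g_sigma_preimage coors (\bigcup_i (F i)).
Proof. exact: sigma_algebra_bigcup. Qed.

HB.instance Definition _ := @isMeasurable.Build rV_display
  'rV[R]_d (g_sigma_preimage coors) rV_set0 rV_setC rV_bigcup.

End rV_measurable.

Section rV_measurable_maps.
Context {R : realType}.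

Lemma measurable_coord d (i : 'I_d) :
  measurable_fun [set: 'rV[R]_d] (fun x : 'rV[R]_d => x ord0 i).
Proof.
move=> _ Y mY; rewrite setTI; apply: sub_sigma_algebra => /=.
rewrite -bigcup_seq/=; exists i => /=; first by rewrite mem_index_enum.
by exists Y => //; rewrite setTI.
Qed.

Lemma measurable_fun_rVP d0 (T : measurableType d0) d (f : T -> 'rV[R]_d) :
  (forall i, measurable_fun [set: T] (fun t => f t ord0 i)) ->
  measurable_fun [set: T] f.
Proof.
move=> mf.
have H (C : set 'rV[R]_d) : measurable C -> measurable (f @^-1` C).
  move=> mC; apply: (@smallest_sub _ (sigma_algebra setT)
    (\big[setU/set0]_(i < d)
        preimage_set_system setT (fun x : 'rV[R]_d => x ord0 i) measurable)
    [set C | measurable (f @^-1` C)] _ _ C mC).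
  - split => /=.
    + by rewrite preimage_set0.
    + by move=> A mA; rewrite setTD preimage_setC; exact: measurableC.
    + by move=> F mF; rewrite preimage_bigcup; exact: bigcup_measurable.
  - rewrite -bigcup_seq; apply: bigcup_sub => i _ A [B mB <-] /=.
    by have := mf i measurableT B mB; rewrite !setTI.
by move=> _ C mC; rewrite setTI; exact: H.
Qed.

Definition rV_cons n (z : measurableTypeR R * 'rV[R]_n) : 'rV[R]_n.+1 :=
  \row_(i < n.+1) oapp (fun j => z.2 ord0 j) z.1 (unlift ord0 i).

Definition rV_uncons n (x : 'rV[R]_n.+1) : measurableTypeR R * 'rV[R]_n :=
  (x ord0 ord0, \row_j x ord0 (lift ord0 j)).

Lemma rV_consK n : cancel (@rV_cons n) (@rV_uncons n).
Proof.
move=> [a x]; congr pair; first by rewrite mxE unlift_none.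
by apply/rowP => j; rewrite !mxE liftK.
Qed.

Lemma measurable_rV_cons n :
  measurable_fun [set: measurableTypeR R * 'rV[R]_n] (@rV_cons n).
Proof.
apply: measurable_fun_rVP => i; rewrite /rV_cons.
case: (unliftP ord0 i) => [j|] ->.
  rewrite (_ : (fun t => _) = (fun x : 'rV[R]_n => x ord0 j) \o snd); last first.
    by apply/funext => t /=; rewrite mxE liftK.
  by apply: measurableT_comp => //; exact: measurable_coord.
rewrite (_ : (fun t => _) = fst) //.
by apply/funext => t /=; rewrite mxE unlift_none.
Qed.

Lemma measurable_rV_uncons n :
  measurable_fun [set: 'rV[R]_n.+1] (@rV_uncons n).
Proof.
apply: measurable_fun_pair; first exact: measurable_coord.
apply: measurable_fun_rVP => i.
rewrite (_ : (fun t => _) = (fun x : 'rV[R]_n.+1 => x ord0 (lift ord0 i))).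
  exact: measurable_coord.
by apply/funext => t /=; rewrite mxE.
Qed.

End rV_measurable_maps.

Lemma sigma_finite_prod d1 d2 (T1 : measurableType d1) (T2 : measurableType d2)
    (R : realType) (m1 : {sigma_finite_measure set T1 -> \bar R})
    (m2 : {sigma_finite_measure set T2 -> \bar R}) :
  sigma_finite setT (m1 \x m2)%E.
Proof.
have /sigma_finiteP[F [TF ndF Foo]] := sigma_finiteT m1.
have /sigma_finiteP[G [TG ndG Goo]] := sigma_finiteT m2.
exists (fun n => F n `*` G n).
  rewrite -setXTT TF TG predeqE => -[x y]; split.
    move=> [/= [n _ Fnx] [k _ Gky]]; exists (maxn n k) => //; split.
    - by move: x Fnx; exact/subsetPset/ndF/leq_maxl.
    - by move: y Gky; exact/subsetPset/ndG/leq_maxr.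
  by move=> [n _ []/= ? ?]; split; exists n.
move=> k; have [? ?] := Foo k; have [? ?] := Goo k.
split; first exact: measurableX.
by rewrite product_measure1E// lte_mul_pinfty// ge0_fin_numE.
Qed.

Section leb_step.
Context {R : realType} {n : nat}.
Variable mu : {sigma_finite_measure set 'rV[R]_n -> \bar R}.
Local Open Scope ereal_scope.

Definition leb_step : set 'rV[R]_n.+1 -> \bar R :=
  pushforward (@lebesgue_measure R \x mu) (@rV_cons R n).

Let leb_step0 : leb_step set0 = 0.
Proof. by rewrite /leb_step /pushforward preimage_set0 measure0. Qed.

Let leb_step_ge0 A : 0 <= leb_step A.
Proof. by apply: integral_ge0 => x _; exact: measure_ge0. Qed.

Let leb_step_sigma_additive : semi_sigma_additive leb_step.
Proof.
have mc (A : set 'rV[R]_n.+1) :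
    measurable A -> measurable (@rV_cons R n @^-1` A).
  by move=> mA; rewrite -[X in measurable X]setTI; exact: measurable_rV_cons.
move=> F mF tF mUF; rewrite /leb_step /pushforward preimage_bigcup.
apply: measure_semi_sigma_additive.
- by move=> k; exact: mc.
- apply/trivIsetP => /= i j _ _ ij; rewrite -preimage_setI.
  by move/trivIsetP : tF => /(_ _ _ _ _ ij) ->//; rewrite preimage_set0.
- by rewrite -preimage_bigcup; exact: mc.
Qed.

HB.instance Definition _ := isMeasure.Build _ _ _ leb_step
  leb_step0 leb_step_ge0 leb_step_sigma_additive.

Let leb_step_sigma_finite : sigma_finite setT leb_step.
Proof.
have [F FT Fm] := sigma_finite_prod (@lebesgue_measure R) mu.
exists (fun k => @rV_uncons R n @^-1` F k).
  by rewrite -preimage_bigcup -FT preimage_setT.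
move=> k; have [mF Foo] := Fm k; split.
  by rewrite -[X in measurable X]setTI; exact: measurable_rV_uncons.
rewrite /leb_step /pushforward -comp_preimage.
rewrite (_ : _ @^-1` _ = F k) //.
by apply/seteqP; split => z; rewrite /= rV_consK.
Qed.

HB.instance Definition _ := Measure_isSigmaFinite.Build _ _ _ leb_step
  leb_step_sigma_finite.

End leb_step.

(* Lebesgue measure on R^d; R^0 is a point of mass 1. *)
Fixpoint leb {R : realType} (d : nat) :
    {sigma_finite_measure set 'rV[R]_d -> \bar R} :=
  if d is n.+1 then leb_step (leb n) else \d_(0 : 'rV[R]_0).

Section calculus.
Context {R : realType} {d : nat}.
Implicit Types (f : 'rV[R]_d -> R) (G : 'rV[R]_d -> 'rV[R]_d).

Definition dotmul (u v : 'rV[R]_d) : R := \sum_i u ord0 i * v ord0 i.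

Definition sqnorm (u : 'rV[R]_d) : R := \sum_i u ord0 i ^+ 2.

Definition partial (i : 'I_d) f (x : 'rV[R]_d) : R :=
  'D_(delta_mx ord0 i) f x.

Definition grad f (x : 'rV[R]_d) : 'rV[R]_d := \row_i partial i f x.

Definition div G (x : 'rV[R]_d) : R :=
  \sum_i partial i (fun y => G y ord0 i) x.

Definition C1 f : Prop :=
  (forall x, differentiable f x) /\ forall i, continuous (partial i f).

Definition C2 f : Prop := C1 f /\ forall i, C1 (partial i f).

Definition C1_field G : Prop := forall i, C1 (fun x => G x ord0 i).

Definition test_function f : Prop :=
  C1 f /\ compact (closure [set x | f x != 0]).

End calculus.

Section wasserstein.
Context {R : realType} {d : nat}.
Local Notation leb := (@leb R d).
Local Open Scope ereal_scope.

Definition density (P : 'rV[R]_d -> R) : Prop :=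
  [/\ measurable_fun [set: 'rV[R]_d] P, forall x, (0 <= P x)%R &
      \int[leb]_x (P x)%:E = 1].

Definition finite_second_moment (P : 'rV[R]_d -> R) : Prop :=
  \int[leb]_x (sqnorm x * P x)%:E < +oo.

(* d/dt p_t = - div (v_t p_t) on [s, s + l] in the sense of distributions,
   integrated in time. Only the values of v and p on [s, s + l] matter. *)
Definition continuity_equation (s l : R) (v : R -> 'rV[R]_d -> 'rV[R]_d)
    (p : R -> 'rV[R]_d -> R) : Prop :=
  forall psi, test_function psi ->
  forall a b : R, (s <= a)%R -> (a <= b)%R -> (b <= s + l)%R ->
    \int[leb]_x (psi x * p b x)%:E - \int[leb]_x (psi x * p a x)%:E =
    \int[lebesgue_measure]_(t in `[a, b]%classic)
      \int[leb]_x (dotmul (grad psi x) (v t x) * p t x)%:E.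

Definition admissible (s l : R) (P Q : 'rV[R]_d -> R)
    (v : R -> 'rV[R]_d -> 'rV[R]_d) (p : R -> 'rV[R]_d -> R) : Prop :=
  [/\ measurable_fun (`[s, (s + l)%R]%classic `*` [set: 'rV[R]_d])
        (fun z : measurableTypeR R * 'rV[R]_d => v z.1 z.2),
      measurable_fun (`[s, (s + l)%R]%classic `*` [set: 'rV[R]_d])
        (fun z : measurableTypeR R * 'rV[R]_d => p z.1 z.2),
      forall t, t \in `[s, (s + l)%R] -> density (p t),
      continuity_equation s l v p &
      p s = P /\ p (s + l)%R = Q].

(* The L^2-Wasserstein distance, as the Benamou-Brenier infimum over paths
   parametrized by [s, s + l] with l > 0; linear changes of time show that the
   value does not depend on (s, l). *)
Definition W2 (s l : R) (P Q : 'rV[R]_d -> R) : \bar R :=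
  sqrte (ereal_inf [set E | exists v p, admissible s l P Q v p /\
    E = l%:E * \int[lebesgue_measure]_(t in `[s, (s + l)%R]%classic)
          \int[leb]_x (sqnorm (v t x) * p t x)%:E]).

End wasserstein.

Section thermodynamics.
Context {R : realType} {d : nat}.
Local Notation leb := (@leb R d).
Local Open Scope ereal_scope.
Implicit Types (mu T : R) (F nu : R -> 'rV[R]_d -> 'rV[R]_d).
Implicit Types (P phi : R -> 'rV[R]_d -> R).

Definition mean_local_velocity mu T F P : R -> 'rV[R]_d -> 'rV[R]_d :=
  fun t x => (mu *: (F t x - T *: grad (fun y => ln (P t y)) x))%R.

Definition kinetic (w : 'rV[R]_d -> 'rV[R]_d) (P : 'rV[R]_d -> R) : \bar R :=
  \int[leb]_x (sqnorm (w x) * P x)%:E.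

Definition entropy_production_rate mu T nu P (tau : R) : \bar R :=
  (mu * T)^-1%:E * kinetic (nu tau) (P tau).

Definition sq_speed (s l : R) P (tau dt : R) : \bar R :=
  W2 s l (P tau) (P (tau + dt)%R) ^+ 2 * ((dt ^+ 2)^-1)%:E.

Definition excess_rate (s l : R) mu T P (tau : R) : \bar R :=
  (mu * T)^-1%:E * lim (sq_speed s l P tau dt @[dt --> (0 : R)%R^']).

Definition housekeeping_rate (s l : R) mu T nu P (tau : R) : \bar R :=
  entropy_production_rate mu T nu P tau - excess_rate s l mu T P tau.

Definition vanishing_boundary_term (G : 'rV[R]_d -> 'rV[R]_d) : Prop :=
  leb.-integrable [set: 'rV[R]_d] (fun x => (div G x)%:E) /\
  \int[leb]_x (div G x)%:E = 0.

End thermodynamics.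

(* Main.v *)
(* Write K for the integral of ||grad phi||^2 P at time tau.  Upper bound: the
   curve t |-> P_t itself, run at constant speed from tau to tau + dt with
   velocity proportional to grad phi_t, is admissible and has action
   dt^2 (K + o(1)).  Lower bound: for a test function psi and any admissible
   path (v, p), Young's inequality 2 c grad psi . v <= ||v||^2 + c^2 ||grad psi||^2
   integrated along the continuity equation bounds the action from below by
   2 c (int psi P_(tau+dt) - int psi P_tau) up to c^2 int int ||grad psi||^2 p_t;
   the same inequality for the function ||grad psi||^2 shows that p_t stays
   close to P_tau.  With c of order dt, the liminf of W_2^2 / dt^2 is at least
   2 int (grad psi . grad phi) P - int ||grad psi||^2 P.  This tends to K for
   psi = chi_n n sin (phi / n), chi_n a cutoff: phi itself need not be
   integrable, but bounded truncations of it are.  Finally the boundary term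
   makes grad phi and nu - grad phi orthogonal in L^2(P), which gives both
   K < oo and the formula for the housekeeping rate. *)
Require Import Defs.
From mathcomp Require Import all_boot all_order all_algebra.
From mathcomp Require Import all_classical all_reals all_analysis.
From mathcomp Require Import measurable_realfun lebesgue_integral_under ring lra.

Set Implicit Arguments.
Unset Strict Implicit.
Unset Printing Implicit Defensive.

Import Order.TTheory GRing.Theory Num.Theory.
Import numFieldNormedType.Exports.

Local Open Scope classical_set_scope.
Local Open Scope ring_scope.

(** * Borel sets of R^d and of R x R^d; cubes *)

Section euclid_measurable.
Context {R : realType}.

(** The competing paths in [W2] carry no regularity: [p t] is a measurable density tied to [v] only
    by the weak equation against compactly supported C1 functions. Every estimate from below must
    therefore be a pairing with such a function. Since ||grad psi||^2 is paired as well, psi has to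
    be C2; hence a cutoff built from the cube of a positive part. The factor n sin (phi / n) and the
    radius n^2 of the cutoff are matched: the cutoff has gradient of order n^-2 and multiplies a
    function of size at most n, so the error in the gradient is O(1/n) uniformly in x, whatever the
    growth of phi. As P has unit mass, ||grad phi||^2 P plus a multiple of P is then an integrable
    dominating function. The error term for p_t contains the action itself, divided by |dt|. This
    circularity is harmless: only actions with l A < dt^2 (K - e) have to be excluded, and for these
    the term is O(|dt|). The increment dt may have either sign, the limit being two-sided; for dt <
    0 the curve is run backwards. *)

Definition qbox d (q : rat * {ffun 'I_d -> rat} * nat) :
    set (measurableTypeR R * 'rV[R]_d) :=
  [set z : measurableTypeR R * 'rV[R]_d | `|z.1 - ratr q.1.1| < q.2.+1%:R^-1 /\
    forall i, `|z.2 ord0 i - ratr (q.1.2 i)| < q.2.+1%:R^-1].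

Lemma measurable_qbox d (q : rat * {ffun 'I_d -> rat} * nat) :
  measurable (qbox q).
Proof.
have mdist (r e : R) : measurable [set x : measurableTypeR R | `|x - r| < e].
  rewrite (_ : [set x | _] = ball r e); first exact: measurable_ball.
  by apply/seteqP; split => x /=; rewrite /ball /= distrC.
rewrite (_ : qbox q =
    fst @^-1` [set x | `|x - ratr q.1.1| < q.2.+1%:R^-1] `&`
    \big[setI/setT]_(i < d)
      ((fun x : 'rV[R]_d => x ord0 i) \o snd) @^-1`
        [set x | `|x - ratr (q.1.2 i)| < q.2.+1%:R^-1]).
  apply: measurableI.
    rewrite -[X in measurable X]setTI.
    by apply: measurable_fst => //; exact: mdist.
  apply: bigsetI_measurable => i _.
  rewrite -[X in measurable X]setTI.
  have : measurable_fun [set: measurableTypeR R * 'rV[R]_d]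
      ((fun x : 'rV[R]_d => x ord0 i) \o snd).
    by apply: measurableT_comp; [exact: measurable_coord|exact: measurable_snd].
  by apply => //; exact: mdist.
apply/seteqP; split => z /=.
  move=> [z1 z2]; split => //.
  by rewrite -bigcap_seq => i _; exact: z2.
move=> [z1]; rewrite -bigcap_seq => z2; split => // i.
by apply: z2; rewrite /= mem_index_enum.
Qed.

(** An open set is the union of the rational boxes [qbox q] that it contains, and there are
    countably many of them. This links the topology of the sup norm with the product sigma-algebra;
    the time factor is included because paths have to be measurable jointly in (t, x). *)
Lemma open_measurable_prod d (V : set (R * 'rV[R]_d)) :
  open V -> measurable (V : set (measurableTypeR R * 'rV[R]_d)).
Proof.
move=> oV.
pose S := \bigcup_(q : rat * {ffun 'I_d -> rat} * nat)
  (if pselect (qbox q `<=` V) then qbox q else set0).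
suff -> : V = S.
  apply: countable_bigcupT_measurable; first exact: countableP.
  by move=> q; case: pselect => ?; [exact: measurable_qbox|exact: measurable0].
apply/seteqP; split => [z Vz|z [q _]]; last by case: pselect => // qV; exact: qV.
have /nbhs_ballP[e /= e0 eV] := open_nbhs_nbhs (conj oV Vz).
(* A box of radius 1/(n+1) around a rational centre that close to z stays within 2/(n+1) < e of
   z. *)
have [n ne] : exists n : nat, n.+1%:R^-1 < e / 2.
  have [n _ nP] := near_infty_natSinv_lt (PosNum (divr_gt0 e0 (ltr0Sn R 1))).
  by exists n; apply: (nP n) => /=.
have n0 : 0 < n.+1%:R^-1 :> R by rewrite invr_gt0.
have approx (x : R) : exists q : rat, `|x - ratr q| < n.+1%:R^-1.
  have [q] : exists q : rat, ratr q \in `]x - n.+1%:R^-1, x + n.+1%:R^-1[.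
    by apply: rat_in_itvoo; rewrite ltrD2l gtrN.
  rewrite in_itv /= => /andP[q1 q2]; exists q.
  by rewrite ltr_distlC q1.
have [q1 q1P] := approx z.1.
have [q2 q2P] := @choice _ _ (fun i q => `|z.2 ord0 i - ratr q| < n.+1%:R^-1)
  (fun i => approx (z.2 ord0 i)).
have tri (a b c k : R) : `|a - b| < k -> `|c - b| < k -> k < e / 2 -> `|a - c| < e.
  move=> ab cb ke; rewrite (le_lt_trans (ler_distD b _ _))// [`|b - c|]distrC.
  lra.
exists (q1, [ffun i => q2 i], n) => //.
case: pselect => [?|]; first by split => //= i; rewrite ffunE.
case; move=> y [/= y1 y2]; apply: eV; split => /=; first by apply: tri ne => /=; [exact: q1P|exact: y1].
split => // i j; rewrite /ball /= !(ord1 i).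
by have := y2 j; rewrite ffunE => ?; exact: tri (q2P j) _ ne.
Qed.

(** V is the section at time 0 of the open cylinder R x V. *)
Lemma open_measurable_rV d (V : set 'rV[R]_d) : open V -> measurable V.
Proof.
move=> oV.
have oV2 : open (snd @^-1` V : set (R * 'rV[R]_d)).
  by apply: open_comp => // z _; exact: cvg_snd.
move: (open_measurable_prod oV2) => /(pair1_measurable (0 : measurableTypeR R) measurableT).
by rewrite setTI.
Qed.

Lemma continuous_measurable_rV d (f : 'rV[R]_d -> R) :
  continuous f -> measurable_fun [set: 'rV[R]_d] f.
Proof.
move=> cf; apply: (measurability _ (RGenOpens.measurableE R)) => //.
move=> _ [_ [a [b ->] <-]]; rewrite setTI.
by apply: open_measurable_rV; apply: open_comp => // x _; exact: cf.
Qed.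

Lemma continuous_measurable_prod d (U : set (R * 'rV[R]_d))
    (f : R * 'rV[R]_d -> R) :
  open U -> (forall z, U z -> {for z, continuous f}) ->
  measurable_fun (U : set (measurableTypeR R * 'rV[R]_d)) f.
Proof.
move=> oU cf; apply: (measurability _ (RGenOpens.measurableE R)) => //.
move=> _ [_ [a [b ->] <-]].
apply: open_measurable_prod.
rewrite openE /interior => z [Uz fz].
apply: filterI; first exact: open_nbhs_nbhs.
by apply: cf => //; apply: open_nbhs_nbhs; split => //; exact: interval_open.
Qed.

(** Cubes serve as the standard compact sets: being products of intervals, they fit the recursive
    construction of [leb] and the slicing by one coordinate. *)
Definition cube d (M : R) : set 'rV[R]_d := [set x | forall i, `|x ord0 i| <= M].

Lemma compact_cube d M : compact (@cube d M).
Proof.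
rewrite (_ : @cube d M = [set x | forall i, `[- M, M]%classic (x ord0 i)]).
  by apply: (@rV_compact R d (fun=> `[- M, M]%classic)) => i; exact: segment_compact.
by apply/seteqP; split => x xM i; have := xM i; rewrite /= in_itv /= ler_norml.
Qed.

Lemma closed_cube d M : closed (@cube d M).
Proof.
rewrite (_ : @cube d M = \bigcap_(i in [set: 'I_d])
    ((fun x : 'rV[R]_d => x ord0 i) @^-1` `[- M, M]%classic)).
  apply: closed_bigI => i _; apply: closed_comp; last exact: interval_closed.
  by move=> x _; exact: coord_continuous.
apply/seteqP; split => x xM i => [_|]; have := xM i; rewrite /= in_itv /= ler_norml //.
exact.
Qed.

Lemma measurable_cube d M : measurable (@cube d M).
Proof.
rewrite -[X in measurable X]setCK; apply: measurableC.
by apply: open_measurable_rV; apply/closed_openC/closed_cube.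
Qed.

Lemma leb_cube d M : (leb d (@cube d M) < +oo)%E.
Proof.
elim: d => [|d IH].
  by rewrite /= diracE; case: (_ \in _); rewrite ltry.
rewrite /= /leb_step /pushforward.
rewrite (_ : _ @^-1` _ = `[- M, M]%classic `*` @cube d M).
  rewrite product_measure1E//; last exact: measurable_cube.
  rewrite lte_mul_pinfty//.
  - by rewrite [X in X \is a fin_num]lebesgue_measure_itv /=; case: ifP.
apply/seteqP; split => [z /= zM|z [/= z1 z2] i].
  split => /=.
    by have := zM ord0; rewrite !mxE unlift_none /= ler_norml in_itv.
  by move=> i; have := zM (lift ord0 i); rewrite !mxE liftK.
rewrite !mxE; case: unliftP => [j _|_] /=; first exact: z2.
by move: z1; rewrite in_itv /= ler_norml.
Qed.

End euclid_measurable.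

(** * Integrals of compactly supported functions and of their partial derivatives *)

Section lebesgue_integration.
Context {R : realType}.

Lemma continuous_rV (T : topologicalType) d (g : T -> 'rV[R]_d) (t : T) :
  (forall i, {for t, continuous (fun x => g x ord0 i)}) -> {for t, continuous g}.
Proof.
move=> cg; apply/cvg_ballP => e e0.
have : \forall x \near t, forall i, ball (g t ord0 i) e (g x ord0 i).
  by apply: filter_forall => i; apply: (cg i); exact: nbhsx_ballx.
by apply: filterS => x gx; split => // i j; rewrite (ord1 i).
Qed.

Lemma integrable_bounded_support d0 (T : measurableType d0)
    (m : {measure set T -> \bar R}) (A : set T) (f : T -> R) (C : R) :
  measurable A -> (m A < +oo)%E -> measurable_fun [set: T] f ->
  (forall x, `|f x| <= C) -> (forall x, ~ A x -> f x = 0) ->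
  m.-integrable [set: T] (EFin \o f).
Proof.
move=> mA mAoo mf fC f0; apply/integrableP; split; first exact/measurable_EFinP.
apply: (@le_lt_trans _ _ (\int[m]_x (C%:E * (\1_A x)%:E))%E).
  apply: ge0_le_integral => //.
  - by apply/measurable_EFinP/measurableT_comp.
  - apply/measurable_EFinP/measurable_funM => //; exact: measurable_indic.
  move=> x _ /=; rewrite -EFinM lee_fin indicE.
  have [xA|xA] := boolP (x \in A); first by rewrite mulr1.
  by rewrite f0 ?normr0 ?mulr0 //; move/negP: xA => xA Ax; apply: xA; rewrite inE.
(* The sign of [C] is read off at any point of [T]; an empty [T] has to be treated apart. *)
have C0 : 0 <= C \/ [set: T] = set0.
  have [[x _]|/nonemptyPn->] := pselect ([set: T] !=set0); last by right.
  by left; exact: le_trans (fC x).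
case: C0 => [C0|->]; last by rewrite integral_set0 ltry.
rewrite ge0_integralZl//; last first.
  by apply/measurable_EFinP; exact: measurable_indic.
by rewrite integral_indic// setIT lte_mul_pinfty.
Qed.

Lemma continuous_cube_bounded d (M : R) (f : 'rV[R]_d -> R) : continuous f ->
  (forall x, ~ cube M x -> f x = 0) -> exists C, forall x, `|f x| <= C.
Proof.
move=> cf f0.
have /compact_bounded [C [_ HC]] : compact (f @` @cube R d M).
  apply: continuous_compact; last exact: compact_cube.
  exact: continuous_subspaceT.
exists (Num.max 0 (C + 1)) => x.
have [xM|xM] := pselect (cube M x); last by rewrite f0// normr0 le_max lexx.
rewrite le_max; apply/orP; right; apply: HC; first by rewrite ltrDl.
by exists x.
Qed.

Lemma integrable_cube d (M : R) (f : 'rV[R]_d -> R) : continuous f ->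
  (forall x, ~ cube M x -> f x = 0) ->
  (leb d).-integrable [set: 'rV[R]_d] (EFin \o f).
Proof.
move=> cf f0; have [C fC] := continuous_cube_bounded cf f0.
apply: integrable_bounded_support f0 => //; first exact: measurable_cube.
- exact: leb_cube.
- exact: continuous_measurable_rV.
Qed.

Lemma partial_cube d (M : R) (f : 'rV[R]_d -> R) (i : 'I_d) x :
  (forall x, ~ cube M x -> f x = 0) -> ~ cube M x -> partial i f x = 0.
Proof.
move=> f0 xM; rewrite /partial.
rewrite (@near_eq_derive _ _ _ _ (cst 0)); first exact: derive_cst.
have : open (~` @cube R d M) by apply/closed_openC/closed_cube.
rewrite openE => /(_ _ xM); apply: filterS => y yM.
by rewrite f0.
Qed.

(** A directional derivative sees only the restriction to a line, so the two functions may live on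
    different spaces. This transfers derivatives from R^(n+1) to slices along the first coordinate
    or along the others. *)
Lemma derive_line (V V' W : normedModType R) (f : V -> W) (g : V' -> W) x v y w :
  (forall h, g (h *: w + y) = f (h *: v + x)) ->
  (derivable f x v -> derivable g y w) /\ 'D_w g y = 'D_v f x.
Proof.
move=> gf.
have E : (fun h : R => h^-1 *: ((g \o shift y) (h *: w) - g y)) =
         (fun h : R => h^-1 *: ((f \o shift x) (h *: v) - f x)).
  by apply/funext => h /=; rewrite gf -[y]add0r -[x in RHS]add0r -(scale0r w) gf scale0r add0r.
by rewrite /derivable /derive E.
Qed.

Lemma rV_cons_head n (h t : R) (x : 'rV[R]_n) :
  rV_cons (h + t, x) = h *: delta_mx ord0 ord0 + rV_cons (t, x).
Proof.
apply/rowP => k; rewrite !mxE /=.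
by case: unliftP => [j ->|->] /=; rewrite ?mulr1 ?mulr0 ?add0r.
Qed.

Lemma rV_cons_tail n (h t : R) (x : 'rV[R]_n) j :
  rV_cons (t, h *: delta_mx ord0 j + x) =
  h *: delta_mx ord0 (lift ord0 j) + rV_cons (t, x).
Proof.
apply/rowP => k; rewrite !mxE /=.
case: unliftP => [i ->|->] /=; last by rewrite mulr0 add0r.
by rewrite !mxE /= (inj_eq (@lift_inj _ _)).
Qed.

Lemma cube_rV_cons n M (t : R) (x : 'rV[R]_n) :
  cube M (rV_cons (t, x)) <-> `|t| <= M /\ cube M x.
Proof.
split=> [H|[tM xM] i].
  split; first by have := H ord0; rewrite !mxE unlift_none.
  by move=> i; have := H (lift ord0 i); rewrite !mxE liftK.
by rewrite !mxE; case: unliftP => [j _|_] /=; [exact: xM|exact: tM].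
Qed.

Lemma continuous_rV_cons_head n (x : 'rV[R]_n) :
  continuous (fun t : R => rV_cons (t, x) : 'rV[R]_n.+1).
Proof.
move=> t; apply: continuous_rV => i.
rewrite (_ : (fun _ => _) = fun t => oapp (fun j => x ord0 j) t (unlift ord0 i)).
  by case: unliftP => [j _|_] /=; [exact: cst_continuous|exact: cvg_id].
by apply/funext => u; rewrite !mxE.
Qed.

Lemma continuous_rV_cons_tail n (t : R) :
  continuous (fun x : 'rV[R]_n => rV_cons (t, x) : 'rV[R]_n.+1).
Proof.
move=> x; apply: continuous_rV => i.
rewrite (_ : (fun _ => _) =
    fun x : 'rV[R]_n => oapp (fun j => x ord0 j) t (unlift ord0 i)).
  case: unliftP => [j _|_] /=; [exact: coord_continuous|exact: cst_continuous].
by apply/funext => u; rewrite !mxE.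
Qed.

(** The fundamental theorem of calculus on an interval whose end points lie outside the support of
    [f]. *)
Lemma integral_derive_support (M : R) (f df : R -> R) :
  (forall t : R, is_derive t 1 f (df t)) -> continuous df ->
  (forall t, M < `|t| -> f t = 0) ->
  (\int[lebesgue_measure]_t (df t)%:E = 0)%E.
Proof.
move=> fdf cdf f0.
have df0 t : M < `|t| -> df t = 0.
  move=> tM; rewrite -(@derive_val _ _ _ _ _ _ _ (fdf t)).
  rewrite (@near_eq_derive _ _ _ _ (cst 0)); first exact: derive_cst.
  by apply: filterS (cvgr_gt _ (@norm_continuous _ R t) _ tM) => u uM; rewrite f0.
(* [M] may be negative; this choice is positive and strictly beyond [M], so that [f] vanishes at
   both N and -N. *)
pose N : R := `|M| + 1.
have MN : M < N by rewrite /N (le_lt_trans (ler_norm M))// ltrDl.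
have N0 : 0 < N by rewrite /N ltr_wpDl.
have -> : (\int[lebesgue_measure]_t (df t)%:E =
    \int[lebesgue_measure]_(t in `[(- N)%R, N]%classic) (df t)%:E)%E.
  rewrite [RHS]integral_mkcond; apply: eq_integral => t _.
  rewrite patchE; case: ifPn => // /negP tN.
  rewrite df0// ltNge; apply/negP => tM; apply: tN.
  by rewrite inE /= in_itv /= -ler_norml (le_trans tM)// ltW.
have cf : continuous f.
  move=> t; apply: differentiable_continuous; apply/derivable1_diffP.
  exact: ex_derive.
rewrite (@continuous_FTC2 _ df f).
- by rewrite !f0 ?subee// ?normrN gtr0_norm.
- by rewrite gtrN.
- exact: continuous_subspaceT.
- split; first by move=> t _; exact: ex_derive.
  + by apply: cvg_at_right_filter; exact: cf.
  + by apply: cvg_at_left_filter; exact: cf.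
- by move=> t _; rewrite derive1E derive_val.
Qed.

(** Induction on the dimension with Fubini. If [i] is the coordinate split off by [rV_cons], the
    inner integral runs over that coordinate and vanishes by the one-dimensional case; otherwise
    every slice with the first coordinate fixed satisfies the induction hypothesis. *)
Lemma integral_partial_eq0 d (i : 'I_d) (M : R) (f : 'rV[R]_d -> R) :
  (forall x, derivable f x (delta_mx ord0 i)) -> continuous (partial i f) ->
  (forall x, ~ cube M x -> f x = 0) ->
  (\int[leb d]_x (partial i f x)%:E = 0)%E.
Proof.
elim: d i f => [[]//|n IH] i f df cf f0.
have pf0 x : ~ cube M x -> partial i f x = 0 by exact: partial_cube.
have mpf : measurable_fun [set: 'rV[R]_n.+1] (partial i f).
  exact: continuous_measurable_rV.
have [C fC] := continuous_cube_bounded cf pf0.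
pose g (z : measurableTypeR R * 'rV[R]_n) := (partial i f (rV_cons z))%:E.
have ig : (@lebesgue_measure R \x leb n)%E.-integrable setT g.
  apply: (@integrable_bounded_support _ _ (@lebesgue_measure R \x leb n)%E
    (@rV_cons R n @^-1` @cube R n.+1 M) (partial i f \o @rV_cons R n) C) => //=.
  - rewrite -[X in measurable X]setTI; apply: measurable_rV_cons => //.
    exact: measurable_cube.
  - exact: (leb_cube n.+1 M).
  - by apply: measurableT_comp => //; exact: measurable_rV_cons.
  - by move=> x xM; exact: pf0.
rewrite /= /leb_step integral_pushforward//=; last 2 first.
- exact: measurable_rV_cons.
- exact/measurable_EFinP.
rewrite preimage_setT.
case: (unliftP ord0 i) => [j|] ij; last first.
  rewrite -(integral21_prod_meas1 ig); apply: integral0_eq => x _.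
  apply: (@integral_derive_support M (fun t => f (rV_cons (t, x)))
    (fun t => partial i f (rV_cons (t, x)))).
  - move=> t.
    have [|Hd He] := @derive_line _ _ _ f (fun t : R => f (rV_cons (t, x)))
      (rV_cons (t, x)) (delta_mx ord0 i) t 1.
      by move=> h; rewrite ij -rV_cons_head [h *: 1]mulr1.
    by split; [exact: Hd|rewrite He].
  - by move=> t; apply: continuous_comp; [exact: continuous_rV_cons_head|exact: cf].
  - move=> t tM; apply: f0 => /cube_rV_cons[].
    by rewrite leNgt tM.
rewrite -(integral12_prod_meas1 ig); apply: integral0_eq => t _.
rewrite /fubini_F /g.
have H x : (derivable f (rV_cons (t, x)) (delta_mx ord0 i) ->
      derivable (fun x => f (rV_cons (t, x))) x (delta_mx ord0 j)) /\
    'D_(delta_mx ord0 j) (fun x => f (rV_cons (t, x))) x =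
    'D_(delta_mx ord0 i) f (rV_cons (t, x)).
  by apply: derive_line => h; rewrite ij rV_cons_tail.
have pE x : partial i f (rV_cons (t, x)) =
    partial j (fun x => f (rV_cons (t, x))) x by rewrite /partial (H x).2.
under eq_integral do rewrite pE.
apply: IH.
- by move=> x; exact: (H x).1.
- rewrite -(_ : (fun x => partial i f (rV_cons (t, x))) =
      partial j (fun x => f (rV_cons (t, x)))); last exact/funext.
  by move=> x; apply: continuous_comp; [exact: continuous_rV_cons_tail|exact: cf].
- by move=> x xM; apply: f0 => /cube_rV_cons[].
Qed.

End lebesgue_integration.

(** * Rules of calculus for C1 and C2 functions, and the Euclidean inner product *)

Section calculus_lemmas.
Context {R : realType} {d : nat}.
Implicit Types (f g : 'rV[R]_d -> R) (h : R -> R).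

Lemma C1_continuous f : C1 f -> continuous f.
Proof. by move=> [df _] x; exact: differentiable_continuous. Qed.

Lemma C1_derivable f i x : C1 f -> derivable f x (delta_mx ord0 i).
Proof. by move=> [df _]; exact: diff_derivable. Qed.

Lemma partialM f g i x : C1 f -> C1 g ->
  partial i (fun y => f y * g y) x = f x * partial i g x + g x * partial i f x.
Proof.
by move=> f1 g1; rewrite /partial; apply: deriveM; exact: C1_derivable.
Qed.

Lemma partialD f g i x : C1 f -> C1 g ->
  partial i (fun y => f y + g y) x = partial i f x + partial i g x.
Proof.
by move=> f1 g1; rewrite /partial; apply: deriveD; exact: C1_derivable.
Qed.

Lemma partialB f g i x : C1 f -> C1 g ->
  partial i (fun y => f y - g y) x = partial i f x - partial i g x.
Proof.
by move=> f1 g1; rewrite /partial; apply: deriveB; exact: C1_derivable.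
Qed.

Lemma partial_cst (c : R) i : partial i (fun _ : 'rV[R]_d => c) = fun=> 0.
Proof. by apply/funext => x; exact: derive_cst. Qed.

Lemma partial_comp h f i x : C1 f -> derivable h (f x) 1 ->
  partial i (fun y => h (f y)) x = (derive1 h) (f x) * partial i f x.
Proof.
move=> [df _] /derivable1_diffP dh; rewrite /partial.
have dhf : differentiable (h \o f) x by exact: differentiable_comp.
rewrite -[fun y => h (f y)]/(h \o f) deriveE// diff_comp//= (deriveE _ (df x)).
by rewrite deriv1E ?[_ *: _]mulrC//; exact/derivable1_diffP.
Qed.

Lemma C1_cst (c : R) : C1 (fun _ : 'rV[R]_d => c).
Proof.
by split=> [x|i]; [exact: differentiable_cst|rewrite partial_cst => x; exact: cst_continuous].
Qed.

Lemma C1D f g : C1 f -> C1 g -> C1 (fun x => f x + g x).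
Proof.
move=> f1 g1; split=> [x|i].
  by apply: differentiableD; [exact: f1.1|exact: g1.1].
rewrite (_ : partial i _ = (fun x => partial i f x + partial i g x)).
  by move=> x; exact: (cvgD (f1.2 i x) (g1.2 i x)).
by apply/funext => x; rewrite partialD.
Qed.

Lemma C1M f g : C1 f -> C1 g -> C1 (fun x => f x * g x).
Proof.
move=> f1 g1; split=> [x|i].
  by apply: differentiableM; [exact: f1.1|exact: g1.1].
rewrite (_ : partial i _ = (fun x => f x * partial i g x + g x * partial i f x)).
  move=> x; apply: (@continuousD _ _ _ (fun x => f x * partial i g x)
    (fun x => g x * partial i f x)); apply: continuousM.
  - exact: C1_continuous.
  - exact: (g1.2 i).
  - exact: C1_continuous.
  - exact: (f1.2 i).
by apply/funext => x; rewrite partialM.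
Qed.

Lemma C1Zl (c : R) f : C1 f -> C1 (fun x => c * f x).
Proof. by move=> f1; exact: (C1M (C1_cst c) f1). Qed.

Lemma C1B f g : C1 f -> C1 g -> C1 (fun x => f x - g x).
Proof.
move=> f1 g1; rewrite (_ : (fun x => _) = fun x => f x + -1 * g x).
  exact: (C1D f1 (C1Zl (-1) g1)).
by apply/funext => x; rewrite mulN1r.
Qed.

Lemma C1_sum (I : Type) (r : seq I) (F : I -> 'rV[R]_d -> R) :
  (forall i, C1 (F i)) -> C1 (fun x => \sum_(i <- r) F i x).
Proof.
move=> F1; elim: r => [|i r IH].
  rewrite (_ : (fun x => _) = fun=> 0); first exact: C1_cst.
  by apply/funext => x; rewrite big_nil.
rewrite (_ : (fun x => _) = fun x => F i x + \sum_(j <- r) F j x).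
  exact: (C1D (F1 i) IH).
by apply/funext => x; rewrite big_cons.
Qed.

Lemma C1_comp h f : (forall t, derivable h t 1) -> continuous (derive1 h) ->
  C1 f -> C1 (fun x => h (f x)).
Proof.
move=> dh ch f1; split=> [x|i].
  by apply: differentiable_comp; [exact: f1.1|exact/derivable1_diffP].
rewrite (_ : partial i _ = (fun x => (derive1 h) (f x) * partial i f x)).
  move=> x; apply: (@continuousM _ _ (fun x => derive1 h (f x)) (partial i f)); last exact: (f1.2 i).
  by apply: continuous_comp; [exact: C1_continuous|exact: ch].
by apply/funext => x; rewrite partial_comp.
Qed.

Lemma C2M f g : C2 f -> C2 g -> C2 (fun x => f x * g x).
Proof.
move=> [f1 f2] [g1 g2]; split; first exact: (C1M f1 g1).
move=> i.
rewrite (_ : partial i _ = (fun x => f x * partial i g x + g x * partial i f x)).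
  apply: (@C1D (fun x => f x * partial i g x) (fun x => g x * partial i f x)).
    exact: (C1M f1 (g2 i)).
  exact: (C1M g1 (f2 i)).
by apply/funext => x; rewrite partialM.
Qed.

Lemma C2_comp h f : (forall t, derivable h t 1) ->
  (forall t, derivable (derive1 h) t 1) -> continuous (derive1 (derive1 h)) ->
  C2 f -> C2 (fun x => h (f x)).
Proof.
move=> dh dh' ch'' [f1 f2]; have ch' : continuous (derive1 h).
  by move=> t; apply: differentiable_continuous; exact/derivable1_diffP.
split; first exact: (C1_comp dh ch' f1).
move=> i; rewrite (_ : partial i _ = (fun x => (derive1 h) (f x) * partial i f x)).
  exact: (C1M (C1_comp dh' ch'' f1) (f2 i)).
by apply/funext => x; rewrite partial_comp.
Qed.

Lemma C2D f g : C2 f -> C2 g -> C2 (fun x => f x + g x).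
Proof.
move=> [f1 f2] [g1 g2]; split; first exact: (C1D f1 g1).
move=> i; rewrite (_ : partial i _ = (fun x => partial i f x + partial i g x)).
  exact: (C1D (f2 i) (g2 i)).
by apply/funext => x; rewrite partialD.
Qed.

Lemma C2_cst (c : R) : C2 (fun _ : 'rV[R]_d => c).
Proof. by split=> [|i]; [exact: C1_cst|rewrite partial_cst; exact: C1_cst]. Qed.

Lemma C2Zl (c : R) f : C2 f -> C2 (fun x => c * f x).
Proof. by move=> f2; exact: (C2M (C2_cst c) f2). Qed.

Lemma partial_coord (i j : 'I_d) :
  partial i (fun x : 'rV[R]_d => x ord0 j) = fun=> (i == j)%:R.
Proof.
apply/funext => x; rewrite /partial /derive; apply: cvg_lim => //.
apply: (@cvg_trans _ ((i == j)%:R @[h --> (0:R)^'])); last exact: cvg_cst.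
apply: near_eq_cvg; near=> h => /=.
rewrite !mxE /= addrK eq_sym [_ *: _]mulrA mulVf ?mul1r//.
by near: h; exact: nbhs_dnbhs_neq.
Unshelve. all: by end_near. Qed.

Lemma C2_coord (j : 'I_d) : C2 (fun x : 'rV[R]_d => x ord0 j).
Proof.
have c1 i : C1 (partial i (fun x : 'rV[R]_d => x ord0 j)).
  by rewrite partial_coord; exact: C1_cst.
split => //; split => [x|i]; first exact: differentiable_coord.
exact: C1_continuous (c1 i).
Qed.

Lemma C2_sum (I : Type) (r : seq I) (F : I -> 'rV[R]_d -> R) :
  (forall i, C2 (F i)) -> C2 (fun x => \sum_(i <- r) F i x).
Proof.
move=> F1; elim: r => [|i r IH].
  rewrite (_ : (fun x => _) = fun=> 0); first exact: C2_cst.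
  by apply/funext => x; rewrite big_nil.
rewrite (_ : (fun x => _) = fun x => F i x + \sum_(j <- r) F j x).
  exact: (C2D (F1 i) IH).
by apply/funext => x; rewrite big_cons.
Qed.

Lemma C2_sqnorm : C2 (@sqnorm R d).
Proof.
apply: C2_sum => i; rewrite (_ : (fun x => _) = fun x : 'rV[R]_d => x ord0 i * x ord0 i).
  exact: (C2M (C2_coord i) (C2_coord i)).
by apply/funext => x; rewrite expr2.
Qed.

Lemma partial_sum (I : Type) (r : seq I) (F : I -> 'rV[R]_d -> R) j x :
  (forall i, C1 (F i)) ->
  partial j (fun x => \sum_(i <- r) F i x) x = \sum_(i <- r) partial j (F i) x.
Proof.
move=> F1; elim: r => [|i r IH].
  rewrite big_nil (_ : (fun x => _) = fun=> 0); first by rewrite partial_cst.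
  by apply/funext => y; rewrite big_nil.
rewrite big_cons -IH -partialD//; last exact: C1_sum.
by congr (partial j _ x); apply/funext => y; rewrite big_cons.
Qed.

Lemma partial_sqnorm (j : 'I_d) x : partial j (@sqnorm R d) x = 2 * x ord0 j.
Proof.
have c1 i := (@C2_coord i).1.
rewrite /sqnorm partial_sum; last first.
  move=> i; rewrite (_ : (fun x => _) = fun x : 'rV[R]_d => x ord0 i * x ord0 i).
    exact: (C1M (c1 i) (c1 i)).
  by apply/funext => y; rewrite expr2.
rewrite (bigD1 j)//= big1 => [|i ij].
  rewrite (_ : (fun x => _) = fun x : 'rV[R]_d => x ord0 j * x ord0 j).
    by rewrite partialM// partial_coord eqxx mulr1n; ring.
  by apply/funext => y; rewrite expr2.
rewrite (_ : (fun x => _) = fun x : 'rV[R]_d => x ord0 i * x ord0 i).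
  by rewrite partialM// partial_coord eq_sym (negbTE ij) mulr0n; ring.
by apply/funext => y; rewrite expr2.
Qed.

Lemma C1_sqnorm_grad f : C2 f -> C1 (fun x => sqnorm (grad f x)).
Proof.
move=> [_ f2]; apply: C1_sum => i.
rewrite (_ : (fun x => _) = fun x => partial i f x * partial i f x).
  exact: (C1M (f2 i) (f2 i)).
by apply/funext => x; rewrite mxE expr2.
Qed.

Lemma dotmulDl (u v w : 'rV[R]_d) : dotmul (u + v) w = dotmul u w + dotmul v w.
Proof. by rewrite /dotmul -big_split /=; apply: eq_bigr => i _; rewrite mxE mulrDl. Qed.

Lemma dotmulC (u v : 'rV[R]_d) : dotmul u v = dotmul v u.
Proof. by apply: eq_bigr => i _; rewrite mulrC. Qed.

Lemma dotmulZl (c : R) (v w : 'rV[R]_d) : dotmul (c *: v) w = c * dotmul v w.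
Proof. by rewrite /dotmul big_distrr /=; apply: eq_bigr => i _; rewrite mxE mulrA. Qed.

Lemma dotmulxx (v : 'rV[R]_d) : dotmul v v = sqnorm v.
Proof. by apply: eq_bigr => i _; rewrite expr2. Qed.

Lemma sqnorm_ge0 (v : 'rV[R]_d) : 0 <= sqnorm v.
Proof. by apply: sumr_ge0 => i _; exact: sqr_ge0. Qed.

Lemma sqnormZ (c : R) (v : 'rV[R]_d) : sqnorm (c *: v) = c ^+ 2 * sqnorm v.
Proof. by rewrite -!dotmulxx dotmulZl dotmulC dotmulZl mulrA expr2. Qed.

Lemma sqnormD (u v : 'rV[R]_d) :
  sqnorm (u + v) = sqnorm u + 2 * dotmul u v + sqnorm v.
Proof.
rewrite -!dotmulxx !dotmulDl !(dotmulC _ (u + v)) !dotmulDl (dotmulC v u); ring.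
Qed.

Lemma norm_dotmul_le (u v : 'rV[R]_d) : 2 * `|dotmul u v| <= sqnorm u + sqnorm v.
Proof.
have h1 := sqnorm_ge0 (u + v); have h2 := sqnorm_ge0 (u + -1 *: v).
rewrite sqnormD in h1; rewrite sqnormD sqnormZ dotmulC dotmulZl dotmulC in h2.
by case: (ger0P (dotmul u v)) => _; lra.
Qed.

End calculus_lemmas.

(** * Test functions and integration by parts *)

Section test_functions.
Context {R : realType} {d : nat}.
Implicit Types (f g psi : 'rV[R]_d -> R).

(** A quantitative form of compact support: the explicit size [M] is inherited by products and
    partial derivatives. *)
Definition cube_supported (M : R) f := forall x, ~ cube M x -> f x = 0.

Lemma test_function_cube (M : R) f : C1 f -> cube_supported M f -> test_function f.
Proof.
move=> f1 fM; split => //.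
apply: (subclosed_compact _ (@compact_cube R d M)); first exact: closed_closure.
rewrite [X in _ `<=` X](closure_id _).1; last exact: closed_cube.
apply: closure_subset => x /= /eqP fx0.
by apply: contrapT => xM; apply: fx0; exact: fM.
Qed.

Lemma test_function_support f : test_function f ->
  exists M, cube_supported M f.
Proof.
move=> [_ cf].
have H (i : 'I_d) : exists M, forall x, closure [set x | f x != 0] x -> `|x ord0 i| <= M.
  have /compact_bounded[M [_ HM]] : compact ((fun x : 'rV[R]_d => x ord0 i) @`
      closure [set x | f x != 0]).
    apply: continuous_compact => //; apply: continuous_subspaceT => x.
    exact: coord_continuous.
  exists (M + 1) => x xf; apply: HM; first by rewrite ltrDl.
  by exists x.
have [M HM] := choice H.
(* The sum is a common bound for the finitely many coordinate bounds [M i]. *)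
exists (\sum_i `|M i|) => x xM; apply: contrapT => fx; apply: xM => i.
apply: le_trans (HM i x _) _; first by apply: subset_closure => /=; exact/eqP.
rewrite (bigD1 i)//= ler_wpDr ?ler_norm//.
by apply: sumr_ge0 => j _; exact: normr_ge0.
Qed.

Lemma cube_supportedM (M : R) f g :
  cube_supported M f -> cube_supported M (fun x => f x * g x).
Proof. by move=> fM x xM; rewrite fM// mul0r. Qed.

Lemma continuous_sumr (I : Type) (r : seq I) (F : I -> 'rV[R]_d -> R) :
  (forall i, continuous (F i)) -> continuous (fun x => \sum_(i <- r) F i x).
Proof.
move=> cF; elim: r => [|i r IH].
  rewrite (_ : (fun x => _) = fun=> 0); first exact: cst_continuous.
  by apply/funext => x; rewrite big_nil.
rewrite (_ : (fun x => _) = fun x => F i x + \sum_(j <- r) F j x).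
  by move=> x; exact: (continuousD (cF i x) (IH x)).
by apply/funext => x; rewrite big_cons.
Qed.

Lemma div_continuous (G : 'rV[R]_d -> 'rV[R]_d) :
  C1_field G -> continuous (div G).
Proof.
by move=> G1; apply: continuous_sumr => i; exact: (G1 i).2.
Qed.

Lemma integral_div_eq0 (M : R) (G : 'rV[R]_d -> 'rV[R]_d) : C1_field G ->
  (forall i, cube_supported M (fun x => G x ord0 i)) ->
  (\int[leb d]_x (div G x)%:E = 0)%E.
Proof.
move=> G1 GM; rewrite /div.
under eq_integral do rewrite -sumEFin.
rewrite integral_sum//; last first.
  move=> i; apply: (@integrable_cube _ _ M); first exact: (G1 i).2.
  by move=> x; apply: partial_cube; exact: GM.
apply: big1 => i _; apply: (@integral_partial_eq0 _ _ i M).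
- by move=> x; exact: C1_derivable.
- exact: (G1 i).2.
- exact: GM.
Qed.

Lemma divM f (G : 'rV[R]_d -> 'rV[R]_d) x : C1 f -> C1_field G ->
  div (fun y => f y *: G y) x = f x * div G x + dotmul (grad f x) (G x).
Proof.
move=> f1 G1; rewrite /div /dotmul mulr_sumr -big_split/=.
apply: eq_bigr => i _.
rewrite (_ : (fun y => _) = fun y => f y * G y ord0 i).
  by rewrite partialM// mxE [_ * G x _ _]mulrC.
by apply/funext => y; rewrite mxE.
Qed.

Lemma C1_fieldM f (G : 'rV[R]_d -> 'rV[R]_d) : C1 f -> C1_field G ->
  C1_field (fun y => f y *: G y).
Proof.
move=> f1 G1 i; rewrite (_ : (fun y => _) = fun y => f y * G y ord0 i).
  exact: (C1M f1 (G1 i)).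
by apply/funext => y; rewrite mxE.
Qed.

Lemma continuous_dotmul (G H : 'rV[R]_d -> 'rV[R]_d) :
  (forall i, continuous (fun x => G x ord0 i)) ->
  (forall i, continuous (fun x => H x ord0 i)) ->
  continuous (fun x => dotmul (G x) (H x)).
Proof.
move=> cG cH; apply: continuous_sumr => i x.
exact: (continuousM (cG i x) (cH i x)).
Qed.

Lemma continuous_grad f i : C1 f -> continuous (fun x => grad f x ord0 i).
Proof.
move=> f1; rewrite (_ : (fun x => _) = partial i f); first exact: f1.2.
by apply/funext => x; rewrite mxE.
Qed.

(** The integral of div (psi G) is zero. All boundary terms are absorbed by the support of [psi], so
    [G] may grow arbitrarily. *)
Lemma integral_by_parts (M : R) psi (G : 'rV[R]_d -> 'rV[R]_d) :
  C1 psi -> cube_supported M psi -> C1_field G ->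
  (\int[leb d]_x (dotmul (grad psi x) (G x))%:E =
   \int[leb d]_x (psi x * - div G x)%:E)%E.
Proof.
move=> psi1 psiM G1.
have sdot x : ~ cube M x -> dotmul (grad psi x) (G x) = 0.
  move=> xM; apply: big1 => i _; rewrite mxE (@partial_cube _ _ M)// mul0r//.
have i1 : (leb d).-integrable setT (EFin \o (fun x => dotmul (grad psi x) (G x))).
  apply: (@integrable_cube _ _ M) => //; apply: continuous_dotmul => i.
  - exact: continuous_grad.
  - exact: C1_continuous.
have i2 : (leb d).-integrable setT (EFin \o (fun x => psi x * - div G x)).
  apply: (@integrable_cube _ _ M); last exact: cube_supportedM.
  move=> x; apply: (@continuousM _ _ psi (fun x => - div G x)).
    exact: C1_continuous.
  by apply: continuousN; exact: (div_continuous G1).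
have : (\int[leb d]_x (dotmul (grad psi x) (G x))%:E -
        \int[leb d]_x (psi x * - div G x)%:E = 0)%E.
  rewrite -integralB//= -[RHS](@integral_div_eq0 M (fun x => psi x *: G x)).
  - by apply: eq_integral => x _; rewrite divM// -EFinB; congr EFin; ring.
  - exact: C1_fieldM.
  - by move=> i x xM; rewrite mxE psiM// mul0r.
have := integrable_fin_num measurableT i1.
have := integrable_fin_num measurableT i2.
rewrite /comp /=; case: (integral _ _ _) => // r; case: (integral _ _ _) => // r' _ _ /eqP.
by rewrite -EFinB eqe subr_eq0 => /eqP ->.
Qed.

End test_functions.

(** * A C2 positive part *)

Section cutoff.
Context {R : realType}.

(** Only u = 0 needs an argument: the difference quotient there is at most |h|^(k+1), hence at most
    |h| for |h| < 1. *)
Lemma derive_maxr0X k (u : R) :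
  is_derive u 1 (fun t : R => Num.max 0 t ^+ k.+2) (k.+2%:R * Num.max 0 u ^+ k.+1).
Proof.
have [u0|u0|->] := ltgtP u 0.
- apply: (@near_eq_is_derive _ _ _ (cst 0)).
  + have := lt_nbhsl u0; apply: filterS => t t0.
    by rewrite (max_idPl (ltW t0)) expr0n.
  + by rewrite expr0n mulr0; exact: is_derive_cst.
- apply: (@near_eq_is_derive R R R (fun t : R => t ^+ k.+2)).
  + have := lt_nbhsr u0; apply: filterS => t t0.
    by rewrite (max_idPr (ltW t0)).
  + have := @is_deriveX R R id k.+2 u 1 1 (is_derive_id _ _).
    by rewrite exprfctE [_ *: 1]mulr1.
- have cv0 : h^-1 *: (((fun t : R => Num.max 0 t ^+ k.+2) \o shift 0) (h *: 1) -
      Num.max 0 0 ^+ k.+2) @[h --> 0^'] --> (0 : R).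
    apply/cvgr0Pnorm_lt => e e0; near=> h.
    have h0 : h != 0 by near: h; exact: nbhs_dnbhs_neq.
    have hn : 0 < `|h| by rewrite normr_gt0.
    have h1 : `|h| < Num.min 1 e.
      by near: h; apply: dnbhs0_lt; rewrite lt_min ltr01.
    move: h1; rewrite lt_min => /andP[h1 he].
    rewrite /= maxxx expr0n subr0 addr0 [h *: 1]mulr1 normrZ normrX normfV.
    have m0 : `|Num.max 0 h| <= `|h|.
      by rewrite ger0_norm ?le_max ?lexx// ge_max normr_ge0 ler_norm.
    apply: le_lt_trans he; rewrite mulrC ler_pdivrMr//.
    rewrite -expr2 (le_trans (lerXn2r _ _ _ m0))//.
    by rewrite -addn2 exprD ler_piMl// exprn_ile1// ltW.
  rewrite expr0n mulr0; split; first by apply/cvg_ex; exists 0.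
  exact: cvg_lim cv0.
Unshelve. all: by end_near. Qed.

(** Three is the least integer power for which the power of the positive part is C2. *)
Definition maxr0_cube (u : R) := Num.max 0 u ^+ 3.

Lemma derivable_maxr0_cube (u : R) : derivable maxr0_cube u 1.
Proof. exact: (@ex_derive _ _ _ _ _ _ _ (derive_maxr0X 1 u)). Qed.

Lemma derive_maxr0_cube : derive1 maxr0_cube = fun u => 3 * Num.max 0 u ^+ 2.
Proof.
apply/funext => u; rewrite derive1E.
exact: (@derive_val _ _ _ _ _ _ _ (derive_maxr0X 1 u)).
Qed.

Lemma is_derive2_maxr0_cube (u : R) :
  is_derive u 1 (derive1 maxr0_cube) (3 *: (2 * Num.max 0 u ^+ 1)).
Proof.
by rewrite derive_maxr0_cube; apply: is_deriveZ; exact: derive_maxr0X.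
Qed.

Lemma continuous_derive2_maxr0_cube : continuous (derive1 (derive1 maxr0_cube)).
Proof.
rewrite (_ : derive1 _ = fun u => 3 *: (2 * Num.max 0 u ^+ 1)).
  move=> u; apply: cvgZr; apply: cvgMr; apply: continuous_max.
    exact: cst_continuous.
  exact: cvg_id.
apply/funext => u; rewrite derive1E.
exact: (@derive_val _ _ _ _ _ _ _ (is_derive2_maxr0_cube u)).
Qed.

Lemma C2_maxr0_cube d (f : 'rV[R]_d -> R) : C2 f -> C2 (fun x => maxr0_cube (f x)).
Proof.
move=> f2; apply: (@C2_comp _ _ maxr0_cube f) => //.
- exact: derivable_maxr0_cube.
- by move=> t; exact: (@ex_derive _ _ _ _ _ _ _ (is_derive2_maxr0_cube t)).
- exact: continuous_derive2_maxr0_cube.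
Qed.

Lemma C2_sin d (f : 'rV[R]_d -> R) : C2 f -> C2 (fun x => sin (f x)).
Proof.
have d1 : derive1 (@sin R) = cos.
  by apply/funext => t; rewrite derive1E derive_val.
have d2 : derive1 (@cos R) = (fun t => - sin t).
  by apply/funext => t; rewrite derive1E derive_val.
move=> f2; apply: (@C2_comp _ _ sin f) => //; rewrite d1 ?d2.
- by move=> t; exact: ex_derive.
- by move=> t; apply: cvgN; exact: continuous_sin.
Qed.

End cutoff.

(** * Approximating grad phi by gradients of compactly supported C2 functions *)

Section gradient_approximation.
Context {R : realType} {d : nat}.
Variable phi : 'rV[R]_d -> R.
Hypothesis phi2 : C2 phi.

(** With a = 1/n this is chi_n n sin (phi / n). The factor a^4 gives chi_n the support |x| <= a^-2
    and a gradient of size at most 6 a^2, which beats the bound a^-1 of the truncated potential by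
    one power of a. *)
Definition trunc_cutoff (a : R) (x : 'rV[R]_d) : R :=
  maxr0_cube (1 - a ^+ 4 * sqnorm x) * (a^-1 * sin (a * phi x)).

Lemma C2_cutoff_arg (a : R) : C2 (fun x : 'rV[R]_d => 1 - a ^+ 4 * sqnorm x).
Proof.
rewrite (_ : (fun x => _) = fun x => 1 + - a ^+ 4 * sqnorm x).
  exact: (C2D (C2_cst 1) (C2Zl _ C2_sqnorm)).
by apply/funext => x; rewrite mulNr.
Qed.

Lemma C2_trunc_cutoff (a : R) : C2 (trunc_cutoff a).
Proof.
exact: (C2M (C2_maxr0_cube (C2_cutoff_arg a)) (C2Zl a^-1 (C2_sin (C2Zl a phi2)))).
Qed.

Lemma coord_sqnorm (x : 'rV[R]_d) i : x ord0 i ^+ 2 <= sqnorm x.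
Proof.
rewrite /sqnorm (bigD1 i)//= lerDl.
by apply: sumr_ge0 => j _; exact: sqr_ge0.
Qed.

Lemma trunc_cutoff_supported (a : R) : 0 < a ->
  cube_supported (a ^- 2) (trunc_cutoff a).
Proof.
move=> a0 x xM; rewrite /trunc_cutoff.
have [i] : exists i, a ^- 2 < `|x ord0 i|.
  apply: contrapT => H; apply: xM => i; rewrite leNgt; apply/negP => xi.
  by apply: H; exists i.
rewrite -(@ltr_pXn2r _ 2) ?nnegrE ?invr_ge0 ?exprn_ge0 ?(ltW a0)//.
rewrite -normrX ger0_norm ?sqr_ge0// => /lt_le_trans/(_ (coord_sqnorm x i)).
rewrite -exprVn -exprM /= exprVn -[_ ^- _]mul1r ltr_pdivrMr ?exprn_gt0// mulrC => xa.
by rewrite /maxr0_cube (max_idPl _) ?expr0n ?mul0r// subr_le0 ltW.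
Qed.

(** The remainder [w] is the gradient of the cutoff times the truncated potential. Its norm is at
    most 6 a^2 a^-1 = 6 a, uniformly in x, which is where 36 comes from. *)
Lemma grad_trunc_cutoff (a : R) x : 0 < a -> exists w,
  grad (trunc_cutoff a) x =
    (maxr0_cube (1 - a ^+ 4 * sqnorm x) * cos (a * phi x)) *: grad phi x + w /\
  sqnorm w <= 36 * a ^+ 2.
Proof.
move=> a0; have an0 : a != 0 by rewrite gt_eqF.
set m := Num.max 0 (1 - a ^+ 4 * sqnorm x).
set s := a^-1 * sin (a * phi x).
exists (- (6 * s * m ^+ 2 * a ^+ 4) *: x); split.
  apply/rowP => i; rewrite !mxE.
  have c1 := C2_cutoff_arg a.
  rewrite (@partialM _ _ (fun x => maxr0_cube (1 - a ^+ 4 * sqnorm x))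
    (fun x => a^-1 * sin (a * phi x))); last 2 first.
  - exact: (C2_maxr0_cube c1).1.
  - exact: (C2Zl a^-1 (C2_sin (C2Zl a phi2))).1.
  rewrite (@partial_comp _ _ maxr0_cube _ _ _ c1.1); last first.
    exact: derivable_maxr0_cube.
  rewrite (@partialB _ _ (fun=> 1) (fun x => a ^+ 4 * sqnorm x)); last 2 first.
  - exact: C1_cst.
  - exact: (C2Zl _ C2_sqnorm).1.
  rewrite partial_cst (@partialM _ _ (fun=> a ^+ 4) (@sqnorm R d)); last 2 first.
  - exact: C1_cst.
  - exact: C2_sqnorm.1.
  rewrite partial_cst partial_sqnorm.
  rewrite (@partialM _ _ (fun=> a^-1) (fun x => sin (a * phi x))); last 2 first.
  - exact: C1_cst.
  - exact: (C2_sin (C2Zl a phi2)).1.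
  rewrite partial_cst (@partial_comp _ _ (@sin R) (fun x => a * phi x)); last 2 first.
  - exact: (C2Zl a phi2).1.
  - exact: ex_derive.
  rewrite (@partialM _ _ (fun=> a) phi); last 2 first.
  - exact: C1_cst.
  - exact: phi2.1.
  rewrite partial_cst derive_maxr0_cube -/m -/s derive1E derive_val.
  by field.
rewrite sqnormZ sqrrN.
have s2 : s ^+ 2 <= a ^- 2.
  rewrite /s exprMn exprVn ler_piMr// ?invr_ge0 ?exprn_ge0 ?(ltW a0)//.
have q0 := sqnorm_ge0 x.
have a4 : 0 < a ^+ 4 by rewrite exprn_gt0.
(* Where [m] does not vanish, both [m] and a^4 |x|^2 are at most 1: the growth of x is controlled by
   the support of the cutoff. *)
have m4 : m ^+ 4 * (a ^+ 4 * sqnorm x) <= 1.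
  rewrite /m; have [qa|qa] := leP 1 (a ^+ 4 * sqnorm x).
    by rewrite (max_idPl _) ?expr0n ?mul0r ?subr_le0.
  rewrite (max_idPr _) ?subr_ge0 ?(ltW qa)//.
  have qa0 : 0 <= a ^+ 4 * sqnorm x by rewrite mulr_ge0 ?(ltW a4).
  rewrite mulr_ile1 ?exprn_ge0 ?(ltW qa) ?subr_ge0 ?(ltW qa)//.
  by rewrite exprn_ile1 ?subr_ge0 ?(ltW qa)// lerBlDr lerDl.
rewrite (_ : _ * sqnorm x =
    36 * (s ^+ 2 * (m ^+ 4 * (a ^+ 4 * sqnorm x))) * a ^+ 4); last by ring.
rewrite -mulrA ler_pM2l// [leRHS](_ : _ = a ^- 2 * 1 * a ^+ 4); last by field.
have m0 : 0 <= m by rewrite /m le_max lexx.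
rewrite ler_pM2r//; apply: ler_pM => //; first exact: sqr_ge0.
by apply: mulr_ge0; [exact: exprn_ge0|exact: mulr_ge0 (ltW a4) q0].
Qed.

(** The bound needed for dominated convergence. It is |u + w|^2 <= 2 |u|^2 + 2 |w|^2, with the
    coefficient of grad phi at most 1 in absolute value and 72 = 2 * 36. *)
Lemma sqnorm_grad_trunc_cutoff (a : R) x : 0 < a -> a <= 1 ->
  sqnorm (grad (trunc_cutoff a) x) <= 2 * sqnorm (grad phi x) + 72.
Proof.
move=> a0 a1; have [w [-> w36]] := grad_trunc_cutoff x a0.
set c := _ * cos _.
have c1 : c ^+ 2 <= 1.
  suff : `|c| ^+ 2 <= 1 by rewrite real_normK ?num_real.
  rewrite exprn_ile1// normrM mulr_ile1 ?normr_ge0 ?cos_max//.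
  rewrite /maxr0_cube normrX exprn_ile1// ger0_norm ?le_max ?lexx//.
  rewrite ge_max ler01/= lerBlDr lerDl mulr_ge0 ?exprn_ge0 ?(ltW a0)//.
  exact: sqnorm_ge0.
have := norm_dotmul_le (c *: grad phi x) w.
have := ler_norm (dotmul (c *: grad phi x) w).
rewrite sqnormD sqnormZ => h1 h2.
have h3 : c ^+ 2 * sqnorm (grad phi x) <= sqnorm (grad phi x).
  by rewrite ler_piMl// sqnorm_ge0.
have a2 : a ^+ 2 <= 1 by rewrite exprn_ile1// ltW.
by lra.
Qed.

Lemma cvg_partial_trunc_cutoff i x :
  partial i (trunc_cutoff n.+1%:R^-1) x @[n --> \oo] --> partial i phi x.
Proof.
pose a n : R := n.+1%:R^-1.
have a0 n : 0 < a n by rewrite invr_gt0.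
have cva : a @ \oo --> 0 by exact: cvg_harmonic.
have [w wP] := choice (fun n => grad_trunc_cutoff x (a0 n)).
have E n : partial i (trunc_cutoff n.+1%:R^-1) x =
    maxr0_cube (1 - a n ^+ 4 * sqnorm x) * cos (a n * phi x) * partial i phi x +
    w n ord0 i.
  by have := congr1 (fun v : 'rV[R]_d => v ord0 i) (wP n).1; rewrite !mxE.
under eq_fun do rewrite E.
have hw : w n ord0 i @[n --> \oo] --> (0 : R).
  have cv6 : 6 * a n @[n --> \oo] --> (0 : R).
    by rewrite -[0](mulr0 6); exact: cvgMr.
  have cv6N : - (6 * a n) @[n --> \oo] --> (0 : R).
    by rewrite -oppr0; exact: cvgN.
  apply: (squeeze_cvgr _ cv6N cv6).
  apply: nearW => n; rewrite -ler_norml -(@ler_pXn2r _ 2)// ?nnegrE ?mulr_ge0 ?(ltW (a0 n))//.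
  rewrite -normrX ger0_norm ?sqr_ge0// (le_trans (coord_sqnorm _ _))//.
  by rewrite (le_trans (wP n).2)// exprMn -natrX.
(* Covers both coefficients: the cutoff is [maxr0_cube] near 1 with a perturbation of order a^4, the
   cosine is taken near 0 with a perturbation of order a. *)
have cvc (h : R -> R) (b : R) k : {for b, continuous h} ->
    forall q, (h (b + a n ^+ k.+1 * q)) @[n --> \oo] --> h b.
  move=> ch q; apply: (@cvg_comp _ _ _ (fun n => b + a n ^+ k.+1 * q) h _ _ _ _ ch).
  have ak : (a n ^+ k.+1) @[n --> \oo] --> (0 : R).
    elim: k => [|k IHk]; first by under eq_fun do rewrite expr1.
    under eq_fun do rewrite exprS.
    by have E0 := cvgM cva IHk; rewrite mulr0 in E0; exact: E0.
  have E0 := cvgD (cvg_cst b) (cvgM ak (cvg_cst q)).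
  by rewrite mul0r addr0 in E0; exact: E0.
have h1 : maxr0_cube (1 - a n ^+ 4 * sqnorm x) @[n --> \oo] --> (1 : R).
  have cm : {for 1, continuous (@maxr0_cube R)}.
    apply: differentiable_continuous; apply/derivable1_diffP.
    exact: derivable_maxr0_cube.
  have := cvc _ _ 3 cm (- sqnorm x).
  under eq_fun do rewrite mulrN.
  by rewrite {2}/maxr0_cube (max_idPr _)// expr1n.
have h2 : cos (a n * phi x) @[n --> \oo] --> (1 : R).
  have := cvc _ 0 0 (@continuous_cos R 0) (phi x).
  by under eq_fun do rewrite add0r expr1; rewrite cos0.
have E0 := cvgD (cvgM (cvgM h1 h2) (cvg_cst (partial i phi x))) hw.
by rewrite mulr1 mul1r addr0 in E0; exact: E0.
Qed.

End gradient_approximation.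

(** * Measurability of space integrals along a path *)

Section path_measurability.
Context {R : realType} {d : nat}.
Local Notation T := (measurableTypeR R).

Lemma measurable_fun_section (D : set T) (g : T * 'rV[R]_d -> R) t :
  measurable D -> measurable_fun (D `*` [set: 'rV[R]_d]) g -> D t ->
  measurable_fun [set: 'rV[R]_d] (fun x => g (t, x)).
Proof.
move=> mD mg Dt.
have mDT : measurable (D `*` [set: 'rV[R]_d]) by exact: measurableX.
move/(measurable_restrictT g mDT)/(measurable_fun_pair2 t) : mg.
by apply: eq_measurable_fun => x _; rewrite patchE mem_set.
Qed.

(** The integrand is known only on the slab over [D], so it is extended by zero. Tonelli is applied
    to the positive and negative parts separately, which requires no integrability of the
    sections. *)
Lemma measurable_fun_integral_section (D : set T) (g : T * 'rV[R]_d -> R) :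
  measurable D -> measurable_fun (D `*` [set: 'rV[R]_d]) g ->
  measurable_fun D (fun t => \int[leb d]_x (g (t, x))%:E)%E.
Proof.
move=> mD mg.
have mDT : measurable (D `*` [set: 'rV[R]_d]) by exact: measurableX.
pose h := EFin \o (g \_ (D `*` [set: 'rV[R]_d])).
have mh : measurable_fun [set: T * 'rV[R]_d] h.
  by apply/measurable_EFinP; exact/(measurable_restrictT g mDT).
apply: (@eq_measurable_fun _ _ _ _ D (fun t => \int[leb d]_x (h (t, x)))%E).
  move=> t /set_mem Dt; apply: eq_integral => x _.
  by rewrite /h /= patchE mem_set.
apply: measurable_funTS.
rewrite (_ : (fun t => _) = (fun t => \int[leb d]_x (h^\+ (t, x))%E -
   \int[leb d]_x (h^\- (t, x))%E)%E); last first.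
  apply/funext => t; rewrite [LHS]integralE; congr (_ - _)%E; apply: eq_integral => x _; [rewrite (funepos_comp h)|rewrite (funeneg_comp h)]=> //.
apply: emeasurable_funB; apply: measurable_fun_fubini_tonelli_F => //.
- exact: measurable_funepos.
- exact: measurable_funeneg.
Qed.

Lemma measurable_dotmul d0 (S : measurableType d0) (D : set S)
    (u w : S -> 'rV[R]_d) : measurable D ->
  measurable_fun D u -> measurable_fun D w ->
  measurable_fun D (fun z => dotmul (u z) (w z)).
Proof.
move=> mD mu mw; apply: measurable_sum => i; apply: measurable_funM.
- exact: (measurableT_comp (measurable_coord i) mu).
- exact: (measurableT_comp (measurable_coord i) mw).
Qed.

Lemma measurable_sqnorm d0 (S : measurableType d0) (D : set S)
    (u : S -> 'rV[R]_d) : measurable D -> measurable_fun D u ->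
  measurable_fun D (fun z => sqnorm (u z)).
Proof.
move=> mD mu; rewrite (_ : (fun z => _) = fun z => dotmul (u z) (u z)).
  exact: measurable_dotmul.
by apply/funext => z; rewrite dotmulxx.
Qed.

Lemma measurable_grad (f : 'rV[R]_d -> R) : C1 f ->
  measurable_fun [set: 'rV[R]_d] (grad f).
Proof.
move=> f1; apply: measurable_fun_rVP => i.
by apply: continuous_measurable_rV; exact: continuous_grad.
Qed.

Lemma integrable_density (q f : 'rV[R]_d -> R) (C : R) : density q ->
  measurable_fun [set: 'rV[R]_d] f -> (forall x, `|f x| <= C) ->
  (leb d).-integrable [set: 'rV[R]_d] (fun x => (f x * q x)%:E).
Proof.
move=> [mq q0 q1] mf fC.
have iq : (leb d).-integrable [set: 'rV[R]_d] (fun x => (q x)%:E).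
  apply/integrableP; split; first exact/measurable_EFinP.
  under eq_integral do rewrite gee0_abs ?lee_fin//.
  by rewrite q1 ltry.
have iCq := integrableZl measurableT C iq.
apply: (le_integrable measurableT _ _ iCq).
  by apply/measurable_EFinP/measurable_funM.
move=> x _; rewrite -EFinM /= lee_fin !normrM ler_wpM2r//.
by rewrite (le_trans (fC x))// ler_norm.
Qed.

End path_measurability.

(** * Young's inequality along an admissible path *)

Section path_inequality.
Context {R : realType} {d : nat}.
Variables (s l : R) (P Q : 'rV[R]_d -> R).
Variables (v : R -> 'rV[R]_d -> 'rV[R]_d) (p : R -> 'rV[R]_d -> R).
Hypothesis vp : admissible s l P Q v p.
Local Notation D := (`[s, s + l]%classic : set (measurableTypeR R)).

Let mv : measurable_fun (D `*` [set: 'rV[R]_d])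
  (fun z : measurableTypeR R * 'rV[R]_d => v z.1 z.2).
Proof. by case: vp. Qed.

Let mp : measurable_fun (D `*` [set: 'rV[R]_d])
  (fun z : measurableTypeR R * 'rV[R]_d => p z.1 z.2).
Proof. by case: vp. Qed.

Let mD : measurable D. Proof. exact: measurable_itv. Qed.

Let mDT : measurable (D `*` [set: 'rV[R]_d]). Proof. exact: measurableX. Qed.

Lemma admissible_density t : D t -> density (p t).
Proof. by move=> Dt; have [_ _ + _ _] := vp; apply. Qed.

Lemma measurable_kinetic_path : measurable_fun D (fun t => kinetic (v t) (p t)).
Proof.
apply: (@measurable_fun_integral_section _ _ D
  (fun z => sqnorm (v z.1 z.2) * p z.1 z.2)) => //.
by apply: measurable_funM => //; exact: measurable_sqnorm.
Qed.

Lemma kinetic_ge0 (w : 'rV[R]_d -> 'rV[R]_d) (q : 'rV[R]_d -> R) :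
  (forall x, 0 <= q x) -> (0 <= kinetic w q)%E.
Proof.
move=> q0; apply: integral_ge0 => x _.
by rewrite lee_fin mulr_ge0// sqnorm_ge0.
Qed.

Variable psi : 'rV[R]_d -> R.
Hypothesis psi1 : C1 psi.
Variable M : R.
Hypothesis psiM : cube_supported M psi.

Let test_psi : test_function psi. Proof. exact: test_function_cube psiM. Qed.

Let pairing t := (\int[leb d]_x (dotmul (grad psi x) (v t x) * p t x)%:E)%E.
Let gsq t := (\int[leb d]_x (sqnorm (grad psi x) * p t x)%:E)%E.

Lemma continuous_sqnorm_grad : continuous (fun x => sqnorm (grad psi x)).
Proof.
rewrite (_ : (fun x => _) = fun x => dotmul (grad psi x) (grad psi x)).
  by apply: continuous_dotmul => i; exact: continuous_grad.
by apply/funext => x; rewrite dotmulxx.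
Qed.

Lemma sqnorm_grad_supported : cube_supported M (fun x => sqnorm (grad psi x)).
Proof.
by move=> x xM; apply: big1 => i _; rewrite mxE (@partial_cube _ _ M)// expr0n.
Qed.

Lemma integrable_sqnorm_grad t : D t ->
  (leb d).-integrable setT (fun x => (sqnorm (grad psi x) * p t x)%:E).
Proof.
move=> Dt; have [C HC] :=
  continuous_cube_bounded continuous_sqnorm_grad sqnorm_grad_supported.
apply: (integrable_density (admissible_density Dt) _ HC).
exact: continuous_measurable_rV continuous_sqnorm_grad.
Qed.

Let mpairing : measurable_fun D pairing.
Proof.
apply: (@measurable_fun_integral_section _ _ D
  (fun z => dotmul (grad psi z.2) (v z.1 z.2) * p z.1 z.2)) => //.
apply: measurable_funM => //; apply: measurable_dotmul => //.
apply: measurable_funTS.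
by apply: (measurableT_comp (measurable_grad psi1)); exact: measurable_snd.
Qed.

Let mgsq : measurable_fun D gsq.
Proof.
apply: (@measurable_fun_integral_section _ _ D
  (fun z => sqnorm (grad psi z.2) * p z.1 z.2)) => //.
apply: measurable_funM => //; apply: measurable_sqnorm => //.
apply: measurable_funTS.
by apply: (measurableT_comp (measurable_grad psi1)); exact: measurable_snd.
Qed.

(** The integrand is dominated by (|grad psi|^2 + |v|^2) p; the first part is integrable because
    [psi] has compact support, the second by finiteness of the kinetic energy. *)
Lemma integrable_pairing t : D t -> (kinetic (v t) (p t) < +oo)%E ->
  (leb d).-integrable setT (fun x => (dotmul (grad psi x) (v t x) * p t x)%:E).
Proof.
move=> Dt Koo; have [mpt p0 _] := admissible_density Dt.
have mvt : measurable_fun [set: 'rV[R]_d] (v t).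
  apply: measurable_fun_rVP => i.
  apply: (@measurable_fun_section _ _ D (fun z => v z.1 z.2 ord0 i)) => //.
  exact: (measurableT_comp (measurable_coord i) mv).
have iK : (leb d).-integrable setT (fun x => (sqnorm (v t x) * p t x)%:E).
  apply/integrableP; split.
    by apply/measurable_EFinP/measurable_funM => //; exact: measurable_sqnorm.
  under eq_integral do rewrite gee0_abs ?lee_fin ?mulr_ge0 ?sqnorm_ge0//.
  exact: Koo.
apply: (le_integrable measurableT _ _
  (integrableD measurableT (integrable_sqnorm_grad Dt) iK)).
  apply/measurable_EFinP/measurable_funM => //; apply: measurable_dotmul => //.
  exact: measurable_grad.
move=> x _; rewrite -EFinD /= lee_fin -mulrDl !normrM ler_wpM2r//.
rewrite (ger0_norm (addr_ge0 _ _)) ?sqnorm_ge0//.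
by apply: le_trans (norm_dotmul_le _ _); rewrite ler_peMl// ler1n.
Qed.

(** The inequality at a fixed time, stated in extended reals: a path of finite action may still have
    infinite kinetic energy at some instants, where the bound is trivial. *)
Lemma young_pairing (c : R) t : D t ->
  ((2 * c)%:E * pairing t <= kinetic (v t) (p t) + (c ^+ 2)%:E * gsq t)%E.
Proof.
move=> Dt; have [mpt p0 _] := admissible_density Dt.
have g0 : (0 <= (c ^+ 2)%:E * gsq t)%E.
  rewrite mule_ge0 ?lee_fin ?sqr_ge0//; apply: integral_ge0 => x _.
  by rewrite lee_fin mulr_ge0// sqnorm_ge0.
have [Koo|] := ltP (kinetic (v t) (p t)) +oo%E; last first.
  by rewrite leye_eq => /eqP ->; rewrite addye ?leey// gt_eqF// (lt_le_trans _ g0).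
have iI := integrable_pairing Dt Koo.
have iG := integrable_sqnorm_grad Dt.
have iK : (leb d).-integrable setT (fun x => (sqnorm (v t x) * p t x)%:E).
  apply/integrableP; split.
    apply/measurable_EFinP/measurable_funM => //; apply: measurable_sqnorm => //.
    apply: measurable_fun_rVP => i.
    apply: (@measurable_fun_section _ _ D (fun z => v z.1 z.2 ord0 i)) => //.
    exact: (measurableT_comp (measurable_coord i) mv).
  under eq_integral do rewrite gee0_abs ?lee_fin ?mulr_ge0 ?sqnorm_ge0//.
  exact: Koo.
rewrite /pairing /gsq /kinetic -!integralZl// -integralD//; last exact: integrableZl.
apply: le_integral => //.
- exact: integrableZl.
- by apply: integrableD => //; exact: integrableZl.
move=> x _; rewrite -!EFinM -EFinD lee_fin mulrA [c ^+ 2 * _]mulrA -mulrDl ler_wpM2r//.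
have := norm_dotmul_le (c *: grad psi x) (v t x).
rewrite sqnormZ dotmulZl; have := ler_norm (c * dotmul (grad psi x) (v t x)).
lra.
Qed.

(** The time integral of [young_pairing], its left-hand side being evaluated by the continuity
    equation. The energy is bounded only in the mean over time, by [A], whereas [B] bounds the
    gradient term at every instant. The sign of [c] is free, as needed for negative time
    increments. *)
Lemma path_inequality (A B c a b : R) :
  (\int[lebesgue_measure]_(t in D) kinetic (v t) (p t) <= A%:E)%E ->
  s <= a -> a <= b -> b <= s + l -> 0 <= B ->
  (forall t, a <= t <= b -> (gsq t <= B%:E)%E) ->
  2 * c * (\int[leb d]_x (psi x * p b x) - \int[leb d]_x (psi x * p a x))
    <= A + c ^+ 2 * (B * (b - a)).
Proof.
move=> KA sa ab bs B0 GB.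
pose I := `[a, b]%classic : set (measurableTypeR R).
have mI : measurable I by exact: measurable_itv.
have ID : I `<=` D.
  move=> t; rewrite /I /= !in_itv/= => /andP[at_ tb].
  by rewrite (le_trans sa)//= (le_trans tb).
have K0 t : D t -> (0 <= kinetic (v t) (p t))%E.
  by move=> Dt; apply: kinetic_ge0 => x; have [_ + _] := admissible_density Dt; apply.
have G0 t : D t -> (0 <= gsq t)%E.
  move=> Dt; apply: integral_ge0 => x _; have [_ p0 _] := admissible_density Dt.
  by rewrite lee_fin mulr_ge0// sqnorm_ge0.
have KI : (\int[lebesgue_measure]_(t in I) kinetic (v t) (p t) <= A%:E)%E.
  apply: le_trans KA; apply: ge0_subset_integral => //.
  exact: measurable_kinetic_path.
have mK : measurable_fun I (fun t => kinetic (v t) (p t)).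
  exact: measurable_funS measurable_kinetic_path.
have mGI : measurable_fun I gsq by exact: measurable_funS mgsq.
have GI : (\int[lebesgue_measure]_(t in I) gsq t <= (B * (b - a))%:E)%E.
  apply: (@le_trans _ _ (\int[lebesgue_measure]_(t in I) B%:E)%E).
    by apply: ge0_le_integral => // t It; exact/G0/ID.
  rewrite integral_cst// [X in (_ * X)%E]lebesgue_measure_itv /= lte_fin.
  rewrite EFinM -EFinB; case: ifPn => // _.
  by rewrite mule0 mule_ge0 ?lee_fin ?subr_ge0.
have iK : lebesgue_measure.-integrable I (fun t => kinetic (v t) (p t)).
  apply/integrableP; split => //.
  apply: le_lt_trans (le_lt_trans KI (ltry _)); rewrite le_eqVlt; apply/orP; left; apply/eqP.
  by apply: eq_integral => t /set_mem It; rewrite gee0_abs//; exact/K0/ID.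
have iG : lebesgue_measure.-integrable I gsq.
  apply/integrableP; split => //.
  apply: le_lt_trans (le_lt_trans GI (ltry _)); rewrite le_eqVlt; apply/orP; left; apply/eqP.
  by apply: eq_integral => t /set_mem It; rewrite gee0_abs//; exact/G0/ID.
(* The Young bounds with c = 1 and c = -1 together give |pairing| <= kinetic + gsq, and they rule
   out the values +oo and -oo wherever the right-hand side is finite. *)
have iIp : lebesgue_measure.-integrable I pairing.
  have mI' : measurable_fun I pairing by exact: measurable_funS mpairing.
  apply: (le_integrable mI mI' _ (integrableD mI iK iG)) => t It.
  have := young_pairing 1 (ID _ It); have := young_pairing (-1) (ID _ It).
  have := K0 _ (ID _ It); have := G0 _ (ID _ It).
  rewrite sqrrN !expr1n !mul1e mulrN mulr1.
  move=> g0 k0; rewrite (gee0_abs (adde_ge0 k0 g0)); move: g0 k0.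
  case: (kinetic _ _) => [k| |]//; last by move=> *; rewrite addye ?leey// gt_eqF// (lt_le_trans _ (G0 _ (ID _ It))).
  case: (gsq t) => [g| |]//; last by move=> *; rewrite addey ?leey.
  case: (pairing t) => [i| |]//=; last 2 first.
  - by move=> _ _ _; rewrite gt0_muley ?lte_fin.
  - by move=> _ _; rewrite lt0_muleNy ?lte_fin ?oppr_lt0.
  rewrite -!EFinD -!EFinM !lee_fin => *.
  by case: (ger0P i) => _; lra.
have Ipsi t : I t -> (leb d).-integrable setT (fun x => (psi x * p t x)%:E).
  move=> It; have [C HC] := continuous_cube_bounded (C1_continuous psi1) psiM.
  apply: (integrable_density (admissible_density (ID _ It)) _ HC).
  exact: continuous_measurable_rV (C1_continuous psi1).
have Ia : I a by rewrite /I /= in_itv /= lexx.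
have Ib : I b by rewrite /I /= in_itv /= lexx andbT.
have [_ _ _ CE _] := vp.
have := CE psi test_psi a b sa ab bs.
have EI t : I t -> (\int[leb d]_x (psi x * p t x)%:E =
    (\int[leb d]_x (psi x * p t x))%:E)%E.
  by move=> It; rewrite /Rintegral fineK//; exact: (integrable_fin_num _ (Ipsi _ It)).
rewrite (EI _ Ib) (EI _ Ia) -EFinB => CEab.
rewrite -lee_fin EFinM CEab -/pairing -integralZl//.
apply: (@le_trans _ _ (\int[lebesgue_measure]_(t in I)
    (kinetic (v t) (p t) + (c ^+ 2)%:E * gsq t))%E).
  apply: le_integral => //.
  - exact: integrableZl.
  - by apply: integrableD => //; exact: integrableZl.
  by move=> t /set_mem It; exact/young_pairing/ID.
rewrite integralD//; last exact: integrableZl.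
rewrite integralZl// EFinD; apply: leeD => //; rewrite [leRHS]EFinM.
by apply: lee_wpmul2l => //; rewrite lee_fin sqr_ge0.
Qed.

End path_inequality.

(** * Lower bound for the action of an arbitrary path *)

Section action_lower_bound.
Context {R : realType} {d : nat}.

Lemma Rintegral_density_le (q f : 'rV[R]_d -> R) (C : R) : density q ->
  (forall x, 0 <= f x <= C) -> measurable_fun [set: 'rV[R]_d] f ->
  (\int[leb d]_x (f x * q x)%:E <= C%:E)%E.
Proof.
move=> [mq q0 q1] fC mf.
have C0 : 0 <= C by have /andP[] := fC 0; exact: le_trans.
apply: (@le_trans _ _ (\int[leb d]_x (C%:E * (q x)%:E))%E).
  apply: ge0_le_integral => //.
  - by move=> x _; rewrite lee_fin mulr_ge0//; have /andP[] := fC x.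
  - exact/measurable_EFinP/measurable_funM.
  - by apply/measurable_EFinP/measurable_funM.
  - by move=> x _; rewrite -EFinM lee_fin ler_wpM2r//; have /andP[] := fC x.
rewrite ge0_integralZl//; last 2 first.
- exact/measurable_EFinP.
- by move=> x _; rewrite lee_fin.
by rewrite q1 mule1.
Qed.

(** [path_inequality] is used twice: for g = |grad psi|^2 on each [s, t], to replace [p t] by [P] in
    the quadratic term, and then for [psi] on the whole interval. The bound [L] on |grad g|^2
    controls the quadratic term of the first use. *)
Lemma action_lower_bound (s l : R) (P Q : 'rV[R]_d -> R) v p psi
    (M A L dt : R) : 0 < l -> dt != 0 -> admissible s l P Q v p ->
  C2 psi -> cube_supported M psi ->
  (forall x, sqnorm (grad (fun y => sqnorm (grad psi y)) x) <= L) ->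
  (\int[lebesgue_measure]_(t in `[s, (s + l)%R]%classic)
     kinetic (v t) (p t) <= A%:E)%E -> 0 <= A ->
  2 * (dt / l) * (\int[leb d]_x (psi x * Q x) - \int[leb d]_x (psi x * P x)) <=
  A + (dt / l) ^+ 2 * (l * (\int[leb d]_x (sqnorm (grad psi x) * P x) +
     (A + dt ^+ 2 * (L * l)) / (2 * `|dt|))).
Proof.
move=> l0 dt0 vp psi2 psiM gL KA A0.
pose g y := sqnorm (grad psi y).
have g1 : C1 g by exact: C1_sqnorm_grad.
have gM : cube_supported M g by exact: sqnorm_grad_supported.
have [_ _ dp _ [ps pl]] := vp.
have ls : s <= s + l by rewrite lerDl ltW.
have L0 : 0 <= L by apply: le_trans (gL 0); exact: sqnorm_ge0.
have n0 : 0 < `|dt| by rewrite normr_gt0.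
have mg1 : measurable_fun [set: 'rV[R]_d] (fun x => sqnorm (grad g x)).
  by apply: continuous_measurable_rV; apply: (continuous_sqnorm_grad g1).
have gfin t : t \in `[s, s + l] ->
    (\int[leb d]_x (g x * p t x)%:E = (\int[leb d]_x (g x * p t x))%:E)%E.
  move=> tD; rewrite /Rintegral fineK//; apply: integrable_fin_num => //.
  exact: (integrable_sqnorm_grad vp psi2.1 psiM).
(* The parameter is |dt|: for an action of order dt^2 both terms on the right are then of order
   dt^2, and the displacement of the integral of [g] is O(|dt|). *)
have gp t : t \in `[s, s + l] -> 2 * `|dt| * (\int[leb d]_x (g x * p t x) -
    \int[leb d]_x (g x * P x)) <= A + dt ^+ 2 * (L * l).
  move=> tD; move: (tD); rewrite in_itv /= => /andP[st ts].
  have GB u : s <= u <= t ->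
      (\int[leb d]_x (sqnorm (grad g x) * p u x)%:E <= L%:E)%E.
    move=> /andP[su ut]; apply: Rintegral_density_le => //.
      by apply: dp; rewrite in_itv /= su (le_trans ut ts).
    by move=> x; rewrite sqnorm_ge0 gL.
  rewrite -ps; apply: le_trans (path_inequality vp g1 gM `|dt| KA (lexx s) st ts L0 GB) _.
  rewrite real_normK ?num_real// lerD2l ler_wpM2l ?sqr_ge0// ler_wpM2l//.
  by rewrite lerBlDl.
set G0 := \int[leb d]_x (sqnorm (grad psi x) * P x).
set B := G0 + _ / _.
have gB t : t \in `[s, s + l] -> \int[leb d]_x (g x * p t x) <= B.
  move=> tD; rewrite -lerBlDl ler_pdivlMr ?mulr_gt0// mulrC.
  exact: gp.
have sD : s \in `[s, s + l] by rewrite in_itv /= lexx ls.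
have B0 : 0 <= B.
  apply: le_trans (gB s sD); apply: Rintegral_ge0 => x _.
  by rewrite mulr_ge0 ?sqnorm_ge0//; have [_ + _] := dp s sD; apply.
have GB t : s <= t <= s + l ->
    (\int[leb d]_x (sqnorm (grad psi x) * p t x)%:E <= B%:E)%E.
  move=> ts; have tD : t \in `[s, s + l] by rewrite in_itv.
  by rewrite -/g (gfin t tD) lee_fin gB.
(* dt / l is the factor by which the velocity is scaled when a time increment dt is covered in a
   time l. *)
have := path_inequality vp psi2.1 psiM (dt / l) KA (lexx s) ls (lexx _) B0 GB.
by rewrite ps pl addrAC subrr add0r [B * l]mulrC.
Qed.

End action_lower_bound.

(** * A local Lipschitz bound from the mean value theorem *)

Section mean_value.
Context {R : realType}.

Lemma lipschitz_derive (f : R -> R) (C t e : R) :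
  (forall r, `|r - t| < e -> derivable f r 1) ->
  (forall r, `|r - t| < e -> `|derive1 f r| <= C) ->
  forall r, `|r - t| < e -> `|f r - f t| <= C * `|r - t|.
Proof.
move=> df fC r rt.
have key a b : a <= b -> (forall u, a <= u <= b -> `|u - t| < e) ->
    `|f b - f a| <= C * `|b - a|.
  move=> ab H.
  have [||c cab ->] := @MVT_segment _ f (derive1 f) a b ab.
  - move=> u; rewrite in_itv /= => /andP[au ub]; apply: DeriveDef.
      by apply: df; apply: H; rewrite !ltW.
    by rewrite derive1E.
  - apply: derivable_within_continuous => u; rewrite in_itv /= => uab.
    exact/df/H.
  - rewrite normrM ler_wpM2r// fC// H//.
have [tr|rt'] := leP t r.
  apply: key => // u /andP[tu ur]; rewrite ger0_norm ?subr_ge0//.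
  by apply: le_lt_trans rt; rewrite ger0_norm ?subr_ge0// lerB.
rewrite distrC [`|r - t|]distrC; apply: key => [|u /andP[ru ut]]; first exact: ltW.
rewrite distrC ger0_norm ?subr_ge0//.
by apply: le_lt_trans rt; rewrite distrC ger0_norm ?subr_ge0 ?lerB// ltW.
Qed.

End mean_value.

(** * The curve P_t and its pairings with test functions *)

Section curve.
Context {R : realType} {d : nat}.
Variables (t0 t1 : R) (P phi : R -> 'rV[R]_d -> R).
Hypothesis hP : forall t, t \in `]t0, t1[ -> density (P t).
Hypothesis hPreg : forall t, t \in `]t0, t1[ -> C1 (P t).
Hypothesis hphireg : forall t, t \in `]t0, t1[ -> C2 (phi t).
Hypothesis hPt : forall t x, t \in `]t0, t1[ -> derivable (fun r => P r x) t 1.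
Hypothesis hPtcont : forall t x, t \in `]t0, t1[ ->
     {for (t, x), continuous (fun z : R * 'rV[R]_d =>
        derive1 (fun r => P r z.2) z.1)}.
Hypothesis hgradcont : forall t x, t \in `]t0, t1[ ->
     {for (t, x), continuous (fun z : R * 'rV[R]_d => grad (phi z.1) z.2)}.
Hypothesis hphi : forall t x, t \in `]t0, t1[ ->
     derive1 (fun r => P r x) t = - div (fun y => P t y *: grad (phi t) y) x.

(** The time derivative is jointly continuous, hence bounded near (t, x); so P is Lipschitz in time
    with a constant uniform in nearby space points. Combined with continuity in space at the fixed
    time t, this gives joint continuity. *)
Lemma continuous_density t x : t \in `]t0, t1[ ->
  {for (t, x), continuous (fun z : R * 'rV[R]_d => P z.1 z.2)}.
Proof.
move=> tI; set dP := fun z : R * 'rV[R]_d => derive1 (fun r => P r z.2) z.1.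
pose C := `|dP (t, x)| + 1.
have C0 : 0 < C by rewrite ltr_wpDl.
have [e e0 he] : exists2 e, 0 < e & forall r y, `|r - t| < e -> ball x e y ->
    `|dP (r, y)| <= C /\ r \in `]t0, t1[.
  have n1 : \forall z \near (t, x), `|dP z| <= C.
    move/cvgrPdist_lt : (@hPtcont t x tI) => /(_ _ ltr01); apply: filterS => z zC.
    rewrite /C -[dP z](subrK (dP (t, x))) (le_trans (ler_normD _ _))//.
    by rewrite addrC lerD2l distrC ltW.
  have n2 : \forall r \near t, r \in `]t0, t1[ by exact: near_in_itvoo.
  have /nbhs_ballP[e1 /= e10 H1] := n1.
  have /nbhs_ballP[e2 /= e20 H2] := n2.
  exists (Num.min e1 e2); first by rewrite lt_min e10.
  move=> r y; rewrite lt_min => /andP[r1 r2] xy; split; last first.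
    by apply: H2; rewrite /ball /= distrC.
  apply: H1; split => /=; first by rewrite /ball /= distrC.
  by apply: le_ball xy; rewrite ge_min lexx.
have nfst (e' : R) : 0 < e' -> \forall z \near (t, x), `|z.1 - t| < e'.
  move=> e'0; have cf : z.1 @[z --> (t, x)] --> t by exact: cvg_fst.
  move/cvgrPdist_lt : cf => /(_ _ e'0).
  by apply: filterS => z; rewrite distrC.
have cs : z.2 @[z --> (t, x)] --> x by exact: cvg_snd.
apply/cvgrPdist_lt => eps eps0.
have n3 : \forall z \near (t, x), ball x e z.2.
  by apply: (cs (fun y => ball x e y)); exact: nbhsx_ballx.
have n4 : \forall z \near (t, x), `|P t x - P t z.2| < eps / 2.
  apply: (cs (fun y => `|P t x - P t y| < eps / 2)).
  by move/cvgrPdist_lt : (@C1_continuous _ _ _ (hPreg tI) x) => /(_ (eps / 2)); apply; rewrite divr_gt0.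
near=> z.
have zt : `|z.1 - t| < e by near: z; exact: nfst.
have zt2 : C * `|z.1 - t| < eps / 2.
  by rewrite mulrC -ltr_pdivlMr//; near: z; apply: nfst; rewrite !divr_gt0.
have zx : ball x e z.2 by near: z.
have zP : `|P t x - P t z.2| < eps / 2 by near: z.
have := @lipschitz_derive _ (fun r => P r z.2) C t e
  (fun r rt => @hPt r z.2 (he _ _ rt zx).2) (fun r rt => (he _ _ rt zx).1) _ zt.
have := ler_distD (P t z.2) (P t x) (P z.1 z.2).
rewrite [`|P t z.2 - _|]distrC /=; lra.
Unshelve. all: by end_near. Qed.

Variables (psi : 'rV[R]_d -> R) (M : R).
Hypothesis psi1 : C1 psi.
Hypothesis psiM : cube_supported M psi.

Let dP r x := derive1 (fun r => P r x) r.
Let h r := (\int[leb d]_x (psi x * dP r x)).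

(** Integration by parts followed by the evolution equation driven by grad phi. Through this
    identity the velocity enters only via the time derivative of P, whose joint continuity is
    assumed. *)
Lemma pairing_velocity r : r \in `]t0, t1[ ->
  (\int[leb d]_x (dotmul (grad psi x) (grad (phi r) x) * P r x)%:E = (h r)%:E)%E.
Proof.
move=> rI.
have G1 : C1_field (fun y => P r y *: grad (phi r) y).
  apply: C1_fieldM; first exact: hPreg.
  move=> i; rewrite (_ : (fun x => _) = partial i (phi r)).
    exact: (hphireg rI).2.
  by apply/funext => x; rewrite mxE.
have E x : dotmul (grad psi x) (grad (phi r) x) * P r x =
    dotmul (grad psi x) (P r x *: grad (phi r) x).
  by rewrite dotmulC -mulrC -dotmulZl dotmulC.
under eq_integral do rewrite E.
have := integral_by_parts psi1 psiM G1; rewrite /= => ->.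
under eq_integral do rewrite -hphi//.
rewrite /h /Rintegral fineK//; apply: integrable_fin_num => //.
apply: (@integrable_cube _ _ M (fun x => psi x * dP r x)); last first.
  exact: cube_supportedM.
move=> x; apply: (@continuousM _ _ psi (dP r)); first exact: C1_continuous.
rewrite (_ : dP r = fun x => - div (fun y => P r y *: grad (phi r) y) x).
  by apply: continuousN; exact: (div_continuous G1).
by apply/funext => y; exact: hphi.
Qed.

Lemma continuous_dP r : r \in `]t0, t1[ -> continuous (dP r).
Proof.
move=> rI x; apply: (@continuous_comp _ _ _ (fun y => (r, y))
   (fun z : R * 'rV[R]_d => derive1 (fun r => P r z.2) z.1)).
  apply: (@cvg_pair _ _ _ (nbhs x) (nbhs r) (nbhs x)); [exact: cvg_cst|exact: cvg_id].
exact: hPtcont.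
Qed.

(** The time derivative is bounded on the compact set [u, v] x cube and [psi] vanishes off the cube;
    this provides one dominating function C |psi| for both differentiation and continuity under the
    integral. *)
Lemma dominated_dP t : t \in `]t0, t1[ -> exists u v C,
  [/\ u < t, t < v, (forall r, u <= r <= v -> r \in `]t0, t1[), 0 <= C &
    forall r x, u <= r <= v -> `|psi x * dP r x| <= C * `|psi x| ].
Proof.
rewrite in_itv /= => /andP[t0t tt1].
(* Midpoints keep the closed interval [u, v] inside the open one. *)
pose u := (t0 + t) / 2; pose v := (t + t1) / 2.
have uvI r : u <= r <= v -> r \in `]t0, t1[.
  by rewrite in_itv /= /u /v => /andP[? ?]; lra.
have cK : compact (`[u, v]%classic `*` @cube R d M).
  by apply: compact_setX; [exact: segment_compact|exact: compact_cube].
have /compact_bounded[C [_ HC]] : compact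
    ((fun z : R * 'rV[R]_d => derive1 (fun r => P r z.2) z.1) @`
      (`[u, v]%classic `*` @cube R d M)).
  apply: continuous_compact => //; apply: continuous_in_subspaceT.
  by move=> [r x] /set_mem[/= ruv _]; apply: hPtcont; apply: uvI.
exists u, v, `|C + 1|; split => //; [rewrite /u; lra|rewrite /v; lra|].
move=> r x ruv; have [xM|xM] := pselect (cube M x); last first.
  by rewrite psiM// mul0r normr0 mulr0.
rewrite normrM mulrC ler_wpM2r// (le_trans _ (ler_norm _))//.
by apply: HC; [rewrite ltrDl|exists (r, x)].
Qed.

Lemma integrable_psi_P r : r \in `]t0, t1[ ->
  (leb d).-integrable setT (EFin \o (fun x => psi x * P r x)).
Proof.
move=> rI; apply: (@integrable_cube _ _ M); last exact: cube_supportedM.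
move=> x; apply: (@continuousM _ _ psi (P r)); apply: C1_continuous => //.
exact: hPreg.
Qed.

Let H r := \int[leb d]_x (psi x * P r x).

Lemma is_derive_pairing t : t \in `]t0, t1[ -> is_derive t 1 H (h t).
Proof.
move=> tI; have [u [v [C [ut tv uvI C0 HC]]]] := dominated_dP tI.
have uvoo r : `]u, v[%classic r -> u <= r <= v.
  by rewrite /= in_itv /= => /andP[? ?]; rewrite !ltW.
have dpsi r x : r \in `]t0, t1[ ->
    is_derive r 1 (fun r => psi x * P r x) (psi x * dP r x).
  move=> rI; have hd := @hPt r x rI.
  apply: (@is_deriveZ _ _ _ (fun r => P r x) (psi x)).
  by apply: DeriveDef => //; rewrite /dP derive1E.
have e1 r x : r \in `]t0, t1[ ->
    partial1of2 (fun r x => psi x * P r x) r x = psi x * dP r x.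
  by move=> rI; rewrite partial1of2E (@derive_val _ _ _ _ _ _ _ (dpsi r x rI)).
have Iuv : `]u, v[%classic t by rewrite /= in_itv /= ut.
have intf r : `]u, v[%classic r ->
    (leb d).-integrable setT (EFin \o (fun x => psi x * P r x)).
  by move=> /uvoo/uvI; exact: integrable_psi_P.
have df r y : `]u, v[%classic r -> setT y ->
    derivable (fun r => psi y * P r y) r 1.
  by move=> /uvoo/uvI rI _; exact: (@ex_derive _ _ _ _ _ _ _ (dpsi r y rI)).
have iG : (leb d).-integrable setT (EFin \o (fun x => C * `|psi x|)).
  apply: (@integrable_cube _ _ M); last by move=> x xM; rewrite psiM// normr0 mulr0.
  move=> x; apply: (@continuousM _ _ (fun=> C) (fun x => `|psi x|)).
    exact: cst_continuous.
  apply: (@continuous_comp _ _ _ psi Num.norm); first exact: C1_continuous.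
  exact: norm_continuous.
have G0 y : 0 <= C * `|psi y| by rewrite mulr_ge0.
have Gub r y : `]u, v[%classic r -> setT y ->
    `|partial1of2 (fun r x => psi x * P r x) r y| <= C * `|psi y|.
  by move=> /uvoo ruv _; rewrite e1 ?uvI// HC.
have D := derivable_under_integral measurableT Iuv intf df G0 iG Gub.
have E := differentiation_under_integral measurableT Iuv intf df G0 iG Gub.
apply: DeriveDef => //; rewrite -derive1E E.
by apply: eq_Rintegral => x _; rewrite e1.
Qed.

(** Continuity of the derivative is what the fundamental theorem of calculus requires in the
    continuity equation of the curve. *)
Lemma continuous_pairing t : t \in `]t0, t1[ -> {for t, continuous h}.
Proof.
move=> tI; have [u [v [C [ut tv uvI C0 HC]]]] := dominated_dP tI.
have uvoo r : `]u, v[%classic r -> u <= r <= v.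
  by rewrite /= in_itv /= => /andP[? ?]; rewrite !ltW.
have Iuv : `]u, v[%classic t by rewrite /= in_itv /= ut.
have intf r : `]u, v[%classic r ->
    (leb d).-integrable setT (EFin \o (fun x => psi x * dP r x)).
  move=> /uvoo/uvI rI; apply: (@integrable_cube _ _ M); last exact: cube_supportedM.
  move=> x; apply: (@continuousM _ _ psi (dP r)); first exact: C1_continuous.
  exact: continuous_dP.
have iG : (leb d).-integrable setT (EFin \o (fun x => C * `|psi x|)).
  apply: (@integrable_cube _ _ M); last by move=> x xM; rewrite psiM// normr0 mulr0.
  move=> x; apply: (@continuousM _ _ (fun=> C) (fun x => `|psi x|)).
    exact: cst_continuous.
  apply: (@continuous_comp _ _ _ psi Num.norm); first exact: C1_continuous.
  exact: norm_continuous.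
apply: (@continuity_under_integral _ _ _ (leb d) (fun r x => psi x * dP r x) setT
   measurableT u v intf _ _ iG); last exact/mem_set.
- apply: aeW => x _ r /set_mem/uvoo/uvI rI.
  apply: (@continuousM _ _ (fun=> psi x) (fun r => dP r x)); first exact: cst_continuous.
  apply: (@continuous_comp _ _ _ (fun r => (r, x))
   (fun z : R * 'rV[R]_d => derive1 (fun r => P r z.2) z.1)).
    apply: (@cvg_pair _ _ _ (nbhs r) (nbhs r) (nbhs x)); [exact: cvg_id|exact: cvg_cst].
  exact: hPtcont.
- by move=> r /uvoo ruv; apply: aeW => x _; exact: HC.
Qed.

End curve.

(** * The reparametrized curve as an admissible path *)

Section curve_path.
Context {R : realType} {d : nat}.
Variables (t0 t1 : R) (P phi : R -> 'rV[R]_d -> R).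
Hypothesis hP : forall t, t \in `]t0, t1[ -> density (P t).
Hypothesis hPreg : forall t, t \in `]t0, t1[ -> C1 (P t).
Hypothesis hphireg : forall t, t \in `]t0, t1[ -> C2 (phi t).
Hypothesis hPt : forall t x, t \in `]t0, t1[ -> derivable (fun r => P r x) t 1.
Hypothesis hPtcont : forall t x, t \in `]t0, t1[ ->
     {for (t, x), continuous (fun z : R * 'rV[R]_d =>
        derive1 (fun r => P r z.2) z.1)}.
Hypothesis hgradcont : forall t x, t \in `]t0, t1[ ->
     {for (t, x), continuous (fun z : R * 'rV[R]_d => grad (phi z.1) z.2)}.
Hypothesis hphi : forall t x, t \in `]t0, t1[ ->
     derive1 (fun r => P r x) t = - div (fun y => P t y *: grad (phi t) y) x.
Variables (s l tau c : R).
Hypothesis l0 : 0 < l.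

Let r (t : R) : R := tau + c * (t - s).
Hypothesis rI : forall t, t \in `[s, s + l] -> r t \in `]t0, t1[.

Local Notation D := (`[s, s + l]%classic : set (measurableTypeR R)).

Lemma measurable_fun_rV_on d0 (S : measurableType d0) (E : set S)
    (f : S -> 'rV[R]_d) : measurable E ->
  (forall i, measurable_fun E (fun z => f z ord0 i)) -> measurable_fun E f.
Proof.
move=> mE mf.
pose f' z : 'rV[R]_d := \row_i ((fun z => f z ord0 i) \_ E) z.
apply: (@eq_measurable_fun _ _ _ _ E f').
  by move=> z zE; apply/rowP => i; rewrite mxE patchE zE.
apply: measurable_funTS; apply: measurable_fun_rVP => i.
rewrite (_ : (fun z => _) = (fun z => f z ord0 i) \_ E).
  exact/(measurable_restrictT _ mE)/mf.
by apply/funext => z; rewrite mxE.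
Qed.

Lemma continuous_reparam : continuous r.
Proof.
move=> t; rewrite /r; apply: (@continuousD _ _ _ (fun=> tau) (fun t => c * (t - s))).
  exact: cst_continuous.
apply: (@continuousM _ _ (fun=> c) (fun t : R => t - s)); first exact: cst_continuous.
apply: (@continuousB _ _ _ (fun t : R => t) (fun=> s)); first exact: cvg_id.
exact: cst_continuous.
Qed.

Lemma is_derive_reparam (t : R) : is_derive t 1 r c.
Proof.
have := is_deriveD (is_derive_cst tau t (1 : R))
  (is_deriveZ c (is_deriveB (is_derive_id t (1 : R)) (is_derive_cst s t (1 : R)))).
by rewrite add0r subr0 [c *: _]mulr1.
Qed.

(** [f] is continuous only over the open time interval, so measurability is first obtained on the
    open set U of points whose reparametrized time lies there, and then restricted to the slab,
    which U contains. *)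
Lemma measurable_reparam (f : R * 'rV[R]_d -> R) :
  (forall t x, t \in `]t0, t1[ -> {for (t, x), continuous f}) ->
  measurable_fun (D `*` [set: 'rV[R]_d])
    (fun z : measurableTypeR R * 'rV[R]_d => f (r z.1, z.2)).
Proof.
move=> cf; pose U : set (R * 'rV[R]_d) := (r \o fst) @^-1` `]t0, t1[%classic.
have oU : open U.
  apply: open_comp; last exact: interval_open.
  move=> z _; apply: continuous_comp; first exact: cvg_fst.
  exact: continuous_reparam.
have : measurable_fun (U : set (measurableTypeR R * 'rV[R]_d))
    (fun z : R * 'rV[R]_d => f (r z.1, z.2)).
  apply: continuous_measurable_prod => // -[t x] Ut.
  apply: (@continuous_comp _ _ _ (fun z : R * 'rV[R]_d => (r z.1, z.2)) f); last exact: cf.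
  apply: (@cvg_pair _ _ _ (nbhs (t, x)) (nbhs (r t)) (nbhs x)); last exact: cvg_snd.
  apply: (@cvg_comp _ _ _ (@fst R 'rV[R]_d) r (nbhs (t, x)) (nbhs t) (nbhs (r t))).
    exact: cvg_fst.
  exact: continuous_reparam.
apply: measurable_funS; last by move=> [t x] [/= tD _]; exact: rI.
exact: open_measurable_prod.
Qed.

(** The factor [c] is the time derivative of the reparametrization [r]; it is negative when the
    curve is traversed backwards. *)
Definition curve_velocity (t : R) (x : 'rV[R]_d) := c *: grad (phi (r t)) x.
Definition curve_density (t : R) := P (r t).

Lemma integrable_curve_pairing (psi : 'rV[R]_d -> R) (M u : R) :
  C1 psi -> cube_supported M psi -> u \in `]t0, t1[ ->
  (leb d).-integrable [set: 'rV[R]_d]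
    (fun x => (dotmul (grad psi x) (grad (phi u) x) * P u x)%:E).
Proof.
move=> psi1 psiM uI.
apply: (@integrable_cube _ _ M (fun x => dotmul (grad psi x) (grad (phi u) x) * P u x)).
  move=> x; apply: (@continuousM _ _ (fun x => dotmul (grad psi x) (grad (phi u) x)) (P u)).
    apply: continuous_dotmul => i; apply: continuous_grad => //.
    exact: (hphireg uI).1.
  exact/C1_continuous/hPreg.
move=> x xM; rewrite /dotmul big1 ?mul0r// => i _.
by rewrite mxE (@partial_cube _ _ M)// mul0r.
Qed.

(** By the chain rule the pairing with P at time r(t) has derivative c h(r(t)), which is the pairing
    with the velocity; the equation is its integrated form. *)
Lemma curve_continuity_equation : continuity_equation s l curve_velocity curve_density.
Proof.
move=> psi tpsi a b sa ab bs; have [psi1 _] := tpsi.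
have [M psiM] := test_function_support tpsi.
have abI t : a <= t <= b -> r t \in `]t0, t1[.
  by move=> /andP[at_ tb]; apply: rI; rewrite in_itv /= (le_trans sa)//= (le_trans tb).
have aI : r a \in `]t0, t1[ by apply: abI; rewrite lexx.
have bI : r b \in `]t0, t1[ by apply: abI; rewrite lexx andbT.
pose h u := \int[leb d]_x (psi x * derive1 (fun r => P r x) u).
pose H u := \int[leb d]_x (psi x * P u x).
have HE u : u \in `]t0, t1[ -> (\int[leb d]_x (psi x * P u x)%:E = (H u)%:E)%E.
  move=> uI; rewrite /H /Rintegral fineK//; apply: integrable_fin_num => //.
  exact: (integrable_psi_P hPreg psi1 psiM).
rewrite /curve_density (HE _ aI) (HE _ bI).
have vE t : a <= t <= b ->
    (\int[leb d]_x (dotmul (grad psi x) (curve_velocity t x) * P (r t) x)%:E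
     = (c * h (r t))%:E)%E.
  move=> /abI rt.
  have hv := pairing_velocity hPreg hphireg hphi psi1 psiM rt.
  rewrite EFinM -hv -integralZl//; last exact: (integrable_curve_pairing psi1 psiM rt).
  apply: eq_integral => x _; rewrite -EFinM /curve_velocity; congr EFin.
  by rewrite dotmulC dotmulZl dotmulC mulrA.
have dH t : a <= t <= b -> is_derive t 1 (H \o r) (h (r t) * c).
  move=> tab; apply: (@is_derive1_comp _ H r); last exact: is_derive_reparam.
  exact: (is_derive_pairing hPreg hPt hPtcont psi1 psiM (abI _ tab)).
have cH t : a <= t <= b -> {for t, continuous (H \o r)}.
  move=> tab; apply: differentiable_continuous; apply/derivable1_diffP.
  exact: (@ex_derive _ _ _ _ _ _ _ (dH t tab)).
transitivity (\int[lebesgue_measure]_(t in `[a, b]%classic) (c * h (r t))%:E)%E; last first.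
  apply: eq_integral => t /set_mem; rewrite /= in_itv /= => tab.
  by rewrite vE.
(* The fundamental theorem of calculus is applied for a < b; for a = b both sides are zero. *)
have [{}ab|ba] := ltP a b; last first.
  have -> : b = a by apply/eqP; rewrite eq_le ab ba.
  by rewrite set_itv1 integral_set1 -EFinB subrr.
rewrite (@continuous_FTC2 _ (fun t => c * h (r t)) (H \o r))//.
- apply: continuous_in_subspaceT => t /set_mem; rewrite /= in_itv /= => tab.
  apply: (@continuousM _ _ (fun=> c) (fun t => h (r t))); first exact: cst_continuous.
  apply: (@continuous_comp _ _ _ r h); first exact: continuous_reparam.
  exact: (continuous_pairing hPtcont psi1 psiM (abI _ tab)).
- split.
  + move=> t; rewrite in_itv /= => /andP[at_ tb].
    by apply: (@ex_derive _ _ _ _ _ _ _ (dH t _)); rewrite !ltW.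
  + by apply: cvg_at_right_filter; apply: cH; rewrite lexx ltW.
  + by apply: cvg_at_left_filter; apply: cH; rewrite lexx ltW.
- move=> t; rewrite in_itv /= => /andP[at_ tb]; rewrite derive1E mulrC.
  by apply: (@derive_val _ _ _ _ _ _ _ (dH t _)); rewrite !ltW.
Qed.

Lemma admissible_curve :
  admissible s l (P tau) (P (tau + c * l)) curve_velocity curve_density.
Proof.
split.
- apply: measurable_fun_rV_on => [|i].
    by apply: measurableX => //; exact: measurable_itv.
  apply: (@measurable_reparam (fun z => (c *: grad (phi z.1) z.2) ord0 i)).
  move=> t x tI.
  rewrite (_ : (fun z => _) = fun z : R * 'rV[R]_d => c * grad (phi z.1) z.2 ord0 i).
    apply: (@continuousM _ _ (fun=> c)); first exact: cst_continuous.
    apply: (@continuous_comp _ _ _ (fun z : R * 'rV[R]_d => grad (phi z.1) z.2)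
       (fun y : 'rV[R]_d => y ord0 i)); first exact: hgradcont.
    exact: coord_continuous.
  by apply/funext => z; rewrite mxE.
- apply: (@measurable_reparam (fun z => P z.1 z.2)) => t x tI.
  exact: (continuous_density hPreg hPt hPtcont).
- by move=> t tD; apply: hP; exact: rI.
- exact: curve_continuity_equation.
- rewrite /curve_density /r subrr mulr0 addr0; split => //.
  by rewrite addrAC subrr add0r.
Qed.

End curve_path.

(** * Orthogonal decomposition of the mean local velocity *)

Section decomposition.
Context {R : realType} {d : nat}.

Lemma divB (G H : 'rV[R]_d -> 'rV[R]_d) x : C1_field G -> C1_field H ->
  div (fun y => G y - H y) x = div G x - div H x.
Proof.
move=> G1 H1; rewrite /div -sumrB; apply: eq_bigr => i _.
rewrite -partialB//; congr (partial i _ x).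
by apply/funext => y; rewrite !mxE.
Qed.

Lemma C1_fieldB (G H : 'rV[R]_d -> 'rV[R]_d) : C1_field G -> C1_field H ->
  C1_field (fun y => G y - H y).
Proof.
move=> G1 H1 i; rewrite (_ : (fun x => _) = fun x => G x ord0 i - H x ord0 i).
  exact: (C1B (G1 i) (H1 i)).
by apply/funext => y; rewrite !mxE.
Qed.

Lemma C1_field_grad (f : 'rV[R]_d -> R) : C2 f -> C1_field (grad f).
Proof.
move=> f2 i; rewrite (_ : (fun x => _) = partial i f); first exact: f2.2.
by apply/funext => y; rewrite mxE.
Qed.

Lemma grad_ln (q : 'rV[R]_d -> R) x : C1 q -> (forall y, 0 < q y) ->
  grad (fun y => ln (q y)) x = (q x)^-1 *: grad q x.
Proof.
move=> q1 q0; apply/rowP => i; rewrite !mxE.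
have [dln lnE] : is_derive (q x) 1 (@ln R) (q x)^-1 by exact: is_derive1_ln.
by rewrite (@partial_comp _ _ (@ln R))// derive1E lnE.
Qed.

Variables (mu T tau : R) (F : R -> 'rV[R]_d -> 'rV[R]_d)
  (P : R -> 'rV[R]_d -> R) (f : 'rV[R]_d -> R).
Hypothesis muT0 : 0 < (mu * T)^-1.
Hypothesis P0 : forall x, 0 < P tau x.
Hypothesis P2 : C2 (P tau).
Hypothesis F1 : C1_field (F tau).
Hypothesis f2 : C2 f.
Local Notation nu := (mean_local_velocity mu T F P tau).
Hypothesis same_div : forall x,
  div (fun y => P tau y *: nu y) x = div (fun y => P tau y *: grad f y) x.
Hypothesis sigma_fin :
  (entropy_production_rate mu T (mean_local_velocity mu T F P) P tau < +oo)%E.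
Hypothesis decay : vanishing_boundary_term (fun x => (f x * P tau x) *: (nu x - grad f x)).

Let w x := nu x - grad f x.

(** Multiplying by P removes the logarithm, so that the probability current is visibly C1; the
    regularity of [nu] itself is recovered by dividing by P > 0. *)
Let PnuE x : P tau x *: nu x = mu *: (P tau x *: F tau x - T *: grad (P tau) x).
Proof.
rewrite /mean_local_velocity grad_ln//; last exact: P2.1.
apply/rowP => i; rewrite !mxE; field.
by rewrite gt_eqF.
Qed.

Let C1_Pnu : C1_field (fun y => P tau y *: nu y).
Proof.
rewrite (_ : (fun y => _) = fun y => mu *: (P tau y *: F tau y - T *: grad (P tau) y)).
  apply: (@C1_fieldM _ _ (fun=> mu)); first exact: C1_cst.
  apply: (@C1_fieldB (fun y => P tau y *: F tau y) (fun y => T *: grad (P tau) y)).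
    by apply: C1_fieldM => //; exact: P2.1.
  apply: (@C1_fieldM _ _ (fun=> T)); first exact: C1_cst.
  exact: C1_field_grad.
exact/funext.
Qed.

Let C1_Pgrad : C1_field (fun y => P tau y *: grad f y).
Proof. by apply: C1_fieldM; [exact: P2.1|exact: C1_field_grad]. Qed.

Let PwE : (fun y => P tau y *: w y) = fun y => P tau y *: nu y - P tau y *: grad f y.
Proof. by apply/funext => y; rewrite /w scalerBr. Qed.

Let C1_Pw : C1_field (fun y => P tau y *: w y).
Proof. by rewrite PwE; exact: C1_fieldB. Qed.

(** In the product rule the term f div (P w) drops out, because P nu and P grad f have the same
    divergence. The boundary condition thus states that grad f and [w] are orthogonal in L^2(P). *)
Let div_decay x : div (fun x => (f x * P tau x) *: w x) x =
  dotmul (grad f x) (P tau x *: w x).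
Proof.
rewrite (_ : (fun x => _) = fun x => f x *: (P tau x *: w x)); last first.
  by apply/funext => y; rewrite scalerA.
by rewrite divM//; [rewrite PwE divB// same_div subrr mulr0 add0r|exact: f2.1].
Qed.

Let measurable_nu : measurable_fun [set: 'rV[R]_d] nu.
Proof.
apply: measurable_fun_rVP => i.
rewrite (_ : (fun x => _) = fun x => (P tau x *: nu x) ord0 i / P tau x); last first.
  by apply/funext => x; rewrite !mxE [X in X / _]mulrC mulfK ?gt_eqF.
apply: continuous_measurable_rV => x.
apply: (@continuousM _ _ (fun x => (P tau x *: nu x) ord0 i) (fun x => (P tau x)^-1)).
  exact: (C1_continuous (C1_Pnu i)).
exact: (cvgV (lt0r_neq0 (P0 x)) (@C1_continuous _ _ _ P2.1 x)).
Qed.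

Let mP : measurable_fun [set: 'rV[R]_d] (P tau).
Proof. exact: (continuous_measurable_rV (C1_continuous P2.1)). Qed.

Let measurable_w : measurable_fun [set: 'rV[R]_d] w.
Proof.
apply: measurable_fun_rVP => i.
rewrite (_ : (fun x => _) = fun x => nu x ord0 i - grad f x ord0 i); last first.
  by apply/funext => x; rewrite /w !mxE.
apply: measurable_funB; first exact: (measurableT_comp (measurable_coord i) measurable_nu).
exact: (measurableT_comp (measurable_coord i) (measurable_grad f2.1)).
Qed.

Lemma integrable_kinetic (u : 'rV[R]_d -> 'rV[R]_d) (q : 'rV[R]_d -> R) :
  measurable_fun [set: 'rV[R]_d] u -> measurable_fun [set: 'rV[R]_d] q ->
  (forall x, 0 <= q x) -> (kinetic u q < +oo)%E ->
  (leb d).-integrable [set: 'rV[R]_d] (fun x => (sqnorm (u x) * q x)%:E).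
Proof.
move=> mu_ mq q0 K; apply/integrableP; split.
  by apply/measurable_EFinP/measurable_funM => //; exact: measurable_sqnorm.
under eq_integral do rewrite gee0_abs ?lee_fin ?mulr_ge0 ?sqnorm_ge0//.
exact: K.
Qed.

(** Finiteness of the two parts is a conclusion: their integrands are nonnegative and their sum
    equals |nu|^2 P minus twice the cross term, where the former is integrable by finite entropy
    production and the latter by the boundary condition. Integrating the same identity gives
    Pythagoras. *)
Lemma kinetic_decomposition : exists K Kw : R,
  [/\ kinetic (grad f) (P tau) = K%:E, kinetic w (P tau) = Kw%:E &
      kinetic nu (P tau) = (K + Kw)%:E].
Proof.
have Pge0 x : 0 <= P tau x by rewrite ltW.
have nufin : (kinetic nu (P tau) < +oo)%E.
  rewrite ltNge leye_eq; apply/negP => /eqP E; move: sigma_fin.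
  by rewrite /entropy_production_rate E gt0_muley ?lte_fin// ltxx.
have inu := integrable_kinetic measurable_nu mP Pge0 nufin.
have [idec dec0] := decay.
have dE : (fun x => (div (fun x => (f x * P tau x) *: (nu x - grad f x)) x)%:E) =
    (fun x => (dotmul (grad f x) (P tau x *: w x))%:E).
  by apply/funext => x; rewrite (div_decay x).
rewrite dE in idec; rewrite dE in dec0.
have id2 := integrableZl measurableT 2 idec.
have mg : measurable_fun [set: 'rV[R]_d] (grad f) := measurable_grad f2.1.
(* The cross term is kept on the right, so that integrability passes from the right-hand side to
   each summand on the left. *)
have key x : sqnorm (grad f x) * P tau x + sqnorm (w x) * P tau x =
    sqnorm (nu x) * P tau x - 2 * dotmul (grad f x) (P tau x *: w x).
  rewrite (_ : nu x = grad f x + w x); last by rewrite /w addrC subrK.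
  by rewrite sqnormD [dotmul _ (P tau x *: _)]dotmulC dotmulZl [dotmul (w x) _]dotmulC; ring.
have iS := integrableB measurableT inu id2.
have ig : (leb d).-integrable setT (fun x => (sqnorm (grad f x) * P tau x)%:E).
  apply: (le_integrable measurableT _ _ iS).
    by apply/measurable_EFinP/measurable_funM => //; exact: measurable_sqnorm.
  move=> x _; rewrite -EFinM -EFinB /= lee_fin -key !ger0_norm ?addr_ge0 ?mulr_ge0 ?sqnorm_ge0//.
  by rewrite lerDl mulr_ge0 ?sqnorm_ge0.
have iw : (leb d).-integrable setT (fun x => (sqnorm (w x) * P tau x)%:E).
  apply: (le_integrable measurableT _ _ iS).
    by apply/measurable_EFinP/measurable_funM => //; exact: measurable_sqnorm.
  move=> x _; rewrite -EFinM -EFinB /= lee_fin -key !ger0_norm ?addr_ge0 ?mulr_ge0 ?sqnorm_ge0//.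
  by rewrite lerDr mulr_ge0 ?sqnorm_ge0.
exists (fine (kinetic (grad f) (P tau))), (fine (kinetic w (P tau))).
have fg : kinetic (grad f) (P tau) \is a fin_num by exact: integrable_fin_num ig.
have fw : kinetic w (P tau) \is a fin_num by exact: integrable_fin_num iw.
rewrite EFinD !fineK//; split => //.
rewrite /kinetic.
have := integralB measurableT inu id2; rewrite integralZl// dec0 mule0 sube0 => <-.
rewrite -integralD//; apply: eq_integral => x _.
by rewrite -EFinM -EFinB -EFinD key.
Qed.

End decomposition.

(** * The limit of W_2^2 / dt^2 *)

Section limit.
Context {R : realType} {d : nat}.

(** The arithmetic that resolves the occurrence of the action [A] in its own error term. Arguing by
    contradiction, the action may be assumed small, which makes the term A / |dt| of order |dt|. *)
Lemma lower_step (l A dt H G L K e J : R) : 0 < l -> dt != 0 -> 0 < e ->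
  2 * (dt / l) * H <=
    A + (dt / l) ^+ 2 * (l * (G + (A + dt ^+ 2 * (L * l)) / (2 * `|dt|))) ->
  `|H / dt - J| <= e / 8 -> K - e / 2 <= 2 * J - G ->
  `|dt| * ((K / l + L * l) / 2) <= e / 8 -> dt ^+ 2 * (K - e) <= l * A.
Proof.
move=> l0 dt0 e0 main; set D := H / dt; rewrite ler_norml => /andP[DJ _] JG small.
have n0 : 0 < `|dt| by rewrite normr_gt0.
set n := `|dt| in main small n0 *.
have dtn : dt ^+ 2 = n ^+ 2 by rewrite /n real_normK ?num_real.
have HE : H = D * dt by rewrite /D divfK.
rewrite leNgt; apply/negP => lt_lA.
(* The action in units of dt^2. After division by n^2 / l the main inequality reads 2 D <= a + G +
   O(n), while the negated claim is a < K - e. *)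
pose a := l * A / n ^+ 2.
have n20 : 0 < n ^+ 2 by rewrite exprn_gt0.
have AE : A = a * n ^+ 2 / l by rewrite /a; field; rewrite !gt_eqF.
have aK : a < K - e by rewrite /a ltr_pdivrMr// [X in _ < X]mulrC -dtn.
have m2 : n ^+ 2 / l * (2 * D) <= n ^+ 2 / l * (a + G + n * ((a / l + L * l) / 2)).
  have -> : n ^+ 2 / l * (2 * D) = 2 * (dt / l) * H.
    by rewrite HE -dtn; field; rewrite gt_eqF.
  apply: le_trans main _; rewrite expr_div_n dtn AE le_eqVlt; apply/orP; left; apply/eqP.
  by field; rewrite !gt_eqF.
rewrite ler_pM2l ?divr_gt0// in m2.
have al : n * (a / l) <= n * (K / l).
  rewrite ler_pM2l// ler_pM2r ?invr_gt0// (le_trans (ltW aK))// lerBlDr lerDl ltW//.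
have small' : n * (K / l) / 2 + n * (L * l) / 2 <= e / 8.
  rewrite (_ : _ + _ = n * ((K / l + L * l) / 2)) //.
  by field; rewrite gt_eqF.
have m3 : 2 * D <= a + G + (n * (a / l) / 2 + n * (L * l) / 2).
  rewrite (_ : _ + _ = a + G + n * ((a / l + L * l) / 2)) //.
  by field; rewrite gt_eqF.
(* The losses are e/2 from the choice of the test function, 2 (e/8) from the difference quotient and
   e/8 from the error term: 7e/8 in all, less than e. *)
by lra.
Qed.

Variables (t0 t1 : R) (P phi : R -> 'rV[R]_d -> R).
Hypothesis hP : forall t, t \in `]t0, t1[ -> density (P t).
Hypothesis hPreg : forall t, t \in `]t0, t1[ -> C1 (P t).
Hypothesis hphireg : forall t, t \in `]t0, t1[ -> C2 (phi t).
Hypothesis hPt : forall t x, t \in `]t0, t1[ -> derivable (fun r => P r x) t 1.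
Hypothesis hPtcont : forall t x, t \in `]t0, t1[ ->
     {for (t, x), continuous (fun z : R * 'rV[R]_d =>
        derive1 (fun r => P r z.2) z.1)}.
Hypothesis hgradcont : forall t x, t \in `]t0, t1[ ->
     {for (t, x), continuous (fun z : R * 'rV[R]_d => grad (phi z.1) z.2)}.
Hypothesis hphi : forall t x, t \in `]t0, t1[ ->
     derive1 (fun r => P r x) t = - div (fun y => P t y *: grad (phi t) y) x.
Variables (s l tau K : R).
Hypothesis l0 : 0 < l.
Hypothesis htau : tau \in `]t0, t1[.
Hypothesis hkin : {for tau, continuous (fun t => kinetic (grad (phi t)) (P t))}.
Hypothesis hK : kinetic (grad (phi tau)) (P tau) = K%:E.

(** Squaring undoes the square root because every action, hence the infimum, is nonnegative. *)
Lemma W2_sqr (Q Q' : 'rV[R]_d -> R) :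
  (W2 s l Q Q' ^+ 2 = ereal_inf [set E | exists v p, admissible s l Q Q' v p /\
    E = l%:E * \int[lebesgue_measure]_(t in `[s, (s + l)%R]%classic)
          kinetic (v t) (p t)])%E.
Proof.
rewrite /W2 sqr_sqrte//; apply/ereal_infP => y [v [p [vp ->]]].
apply: mule_ge0; first by rewrite lee_fin ltW.
apply: integral_ge0 => t Dt; apply: kinetic_ge0 => x.
by have [_ + _] := admissible_density vp Dt; apply.
Qed.

(** By continuity of the kinetic energy at [tau] it is at most K + e at all times visited for small
    dt. The curve at speed c = dt / l then has action l * (c^2 (K + e) l) = dt^2 (K + e). *)
Lemma sq_speed_le (e : R) : 0 < e ->
  \forall dt \near (0 : R)^', (sq_speed s l P tau dt <= (K + e)%:E)%E.
Proof.
move=> e0.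
have n1 : \forall u \near tau, (kinetic (grad (phi u)) (P u) <= (K + e)%:E)%E.
  have hc : kinetic (grad (phi u)) (P u) @[u --> tau] --> K%:E by rewrite -hK; exact: hkin.
  move/fine_cvgP : hc => [hfin /cvgrPdist_lt/(_ _ e0) hc].
  near=> u; have uf : kinetic (grad (phi u)) (P u) \is a fin_num by near: u.
  rewrite -(fineK uf) lee_fin.
  have : `|K - fine (kinetic (grad (phi u)) (P u))| < e by near: u.
  by rewrite ltr_distlC => /andP[_ /ltW].
have n2 : \forall u \near tau, u \in `]t0, t1[ by exact: near_in_itvoo.
have /nbhs_ballP[e1 /= e10 H1] := n1.
have /nbhs_ballP[e2 /= e20 H2] := n2.
near=> dt.
have dt0 : dt != 0 by near: dt; exact: nbhs_dnbhs_neq.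
have dtm : `|dt| < Num.min e1 e2.
  by near: dt; apply: dnbhs0_lt; rewrite lt_min e10.
move: dtm; rewrite lt_min => /andP[dt1 dt2].
pose c := dt / l.
have rdt t : t \in `[s, s + l] -> `|tau - (tau + c * (t - s))| <= `|dt|.
  rewrite in_itv /= => /andP[st ts].
  rewrite opprD addNKr normrN normrM /c normrM normfV (gtr0_norm l0) -mulrA.
  rewrite ler_piMr// mulrC ler_pdivrMr// mul1r ger0_norm ?subr_ge0//.
  by rewrite lerBlDl.
have rI t : t \in `[s, s + l] -> tau + c * (t - s) \in `]t0, t1[.
  by move=> tD; apply: H2; rewrite /ball /= (le_lt_trans (rdt t tD)).
have adm := admissible_curve hP hPreg hphireg hPt hPtcont hgradcont hphi rI.
have cl : c * l = dt by rewrite /c divfK// gt_eqF.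
rewrite cl in adm.
have le1 : (W2 s l (P tau) (P (tau + dt)%R) ^+ 2 <= (dt ^+ 2 * (K + e))%:E)%E.
  rewrite W2_sqr; apply: ge_ereal_inf; eexists.
    by exists (curve_velocity phi s tau c), (curve_density P s tau c); split; first exact: adm.
  rewrite (_ : (dt ^+ 2 * (K + e))%:E = l%:E * (c ^+ 2 * (K + e) * l)%:E)%E; last first.
    by rewrite -EFinM /c; congr EFin; field; rewrite gt_eqF.
  apply: lee_wpmul2l; first by rewrite lee_fin ltW.
  apply: (@le_trans _ _ (\int[lebesgue_measure]_(t in `[s, (s + l)%R]%classic) (c ^+ 2 * (K + e))%:E)%E).
    have kE t : t \in `[s, s + l] ->
        (kinetic (curve_velocity phi s tau c t) (curve_density P s tau c t) <= (c ^+ 2 * (K + e))%:E)%E.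
      move=> tD; have [mp p0 _] := hP (rI t tD).
      rewrite (_ : kinetic _ _ = (c ^+ 2)%:E * kinetic (grad (phi (tau + c * (t - s))))
         (P (tau + c * (t - s))))%E; last first.
        rewrite /kinetic -ge0_integralZl//; last 3 first.
        - apply/measurable_EFinP/measurable_funM => //; apply: measurable_sqnorm => //.
          exact: (measurable_grad (hphireg (rI t tD)).1).
        - by move=> x _; rewrite lee_fin mulr_ge0// sqnorm_ge0.
        - by rewrite lee_fin sqr_ge0.
        apply: eq_integral => x _.
        by rewrite -EFinM /curve_velocity /curve_density sqnormZ mulrA.
      rewrite [leRHS]EFinM; apply: lee_wpmul2l; first by rewrite lee_fin sqr_ge0.
      by apply: H1; rewrite /ball /= (le_lt_trans (rdt t tD)).
    apply: ge0_le_integral => //.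
    - by move=> t Dt; apply: kinetic_ge0 => x; have [_ + _] := admissible_density adm Dt; apply.
    - exact: (measurable_kinetic_path adm).
  rewrite integral_cst// [X in (_ * X)%E]lebesgue_measure_itv /= lte_fin ltrDl l0.
  by rewrite -EFinD addrAC subrr add0r -EFinM.
rewrite /sq_speed; apply: le_trans (lee_wpmul2r _ le1) _.
  by rewrite lee_fin invr_ge0 sqr_ge0.
rewrite -EFinM lee_fin mulrAC mulfV ?mul1r// sqrf_eq0//.
Unshelve. all: by end_near. Qed.

Lemma cvg_sum_seq (I : Type) (q : seq I) (u : I -> nat -> R) (v : I -> R) :
  (forall i, u i n @[n --> \oo] --> v i) ->
  \sum_(i <- q) u i n @[n --> \oo] --> \sum_(i <- q) v i.
Proof.
move=> cu; elim: q => [|i q IH].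
  rewrite big_nil; under eq_fun do rewrite big_nil; exact: cvg_cst.
rewrite big_cons; under eq_fun do rewrite big_cons.
exact: (cvgD (cu i) IH).
Qed.

(** The functional 2 <grad psi, grad phi> - |grad psi|^2 equals |grad phi|^2 - |grad psi - grad
    phi|^2, so its supremum K is approached along truncations whose gradients converge to grad phi.
    The convergence is pointwise, with domination. *)
Lemma gradient_test_function (e : R) : 0 < e -> exists psi M,
  [/\ C2 psi, cube_supported M psi &
    K - e <= 2 * \int[leb d]_x (dotmul (grad psi x) (grad (phi tau) x) * P tau x)
             - \int[leb d]_x (sqnorm (grad psi x) * P tau x)].
Proof.
move=> e0; have phi2 := hphireg htau; have Pden := hP htau; have [mP P0 P1] := Pden.
pose a n : R := n.+1%:R^-1.
have a0 n : 0 < a n by rewrite invr_gt0.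
have a1 n : a n <= 1 by rewrite invf_le1// ler1n.
pose psi n := trunc_cutoff (phi tau) (a n).
have psi2 n : C2 (psi n) by exact: C2_trunc_cutoff.
have psiM n : cube_supported (a n ^- 2) (psi n) by exact: trunc_cutoff_supported.
pose J n x := dotmul (grad (psi n) x) (grad (phi tau) x) * P tau x.
pose G n x := sqnorm (grad (psi n) x) * P tau x.
have mg : measurable_fun [set: 'rV[R]_d] (grad (phi tau)) := measurable_grad phi2.1.
have mpsi n : measurable_fun [set: 'rV[R]_d] (grad (psi n)) := measurable_grad (psi2 n).1.
have iJ n : (leb d).-integrable setT (EFin \o J n).
  exact: (integrable_curve_pairing hPreg hphireg (psi2 n).1 (psiM n) htau).
have iG n : (leb d).-integrable setT (EFin \o G n).
  have cg := continuous_sqnorm_grad (psi2 n).1.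
  have [C HC] := continuous_cube_bounded cg (sqnorm_grad_supported (psiM n)).
  exact: (integrable_density Pden (continuous_measurable_rV cg) HC).
have iphi : (leb d).-integrable setT (fun x => (sqnorm (grad (phi tau) x) * P tau x)%:E).
  apply/integrableP; split.
    by apply/measurable_EFinP/measurable_funM => //; exact: measurable_sqnorm.
  under eq_integral do rewrite gee0_abs ?lee_fin ?mulr_ge0 ?sqnorm_ge0//.
  by move: hK; rewrite /kinetic => ->; rewrite ltry.
have iP : (leb d).-integrable setT (fun x => (P tau x)%:E).
  apply/integrableP; split; first exact/measurable_EFinP.
  under eq_integral do rewrite gee0_abs ?lee_fin//.
  by rewrite P1 ltry.
(* |2 J - G| is at most (2 |grad psi|^2 + |grad phi|^2) P, and |grad psi|^2 <= 2 |grad phi|^2 + 72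
   turns this into (5 |grad phi|^2 + 144) P. *)
have ibound := integrableD measurableT (integrableZl measurableT 5 iphi)
  (integrableZl measurableT 144 iP).
have cv : (\int[leb d]_x (2 * J n x - G n x)%:E)%E @[n --> \oo] --> K%:E.
  rewrite -hK; apply: (dominated_cvg measurableT _ _ _ ibound) => //.
  - move=> n; apply/measurable_EFinP/measurable_funB.
      apply: measurable_funM => //; apply: measurable_funM => //.
      exact: measurable_dotmul.
    by apply: measurable_funM => //; exact: measurable_sqnorm.
  - move=> x _; apply: cvg_EFin; first exact: nearW.
    have cp i : partial i (psi n) x @[n --> \oo] --> partial i (phi tau) x.
      exact: cvg_partial_trunc_cutoff.
    have cq i : 2 * (partial i (psi n) x * partial i (phi tau) x)
        - partial i (psi n) x * partial i (psi n) x @[n --> \oo] -->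
        2 * (partial i (phi tau) x * partial i (phi tau) x)
        - partial i (phi tau) x * partial i (phi tau) x.
      exact: (cvgB (cvgM (cvg_cst (2 : R)) (cvgM (cp i) (cvg_cst (partial i (phi tau) x))))
        (cvgM (cp i) (cp i))).
    have cS := @cvg_sum_seq _ (index_enum 'I_d) _ _ cq.
    have cS' := cvgM cS (cvg_cst (P tau x)).
    rewrite [X in _ --> X](_ : _ = (\sum_i (2 * (partial i (phi tau) x * partial i (phi tau) x)
        - partial i (phi tau) x * partial i (phi tau) x)) * P tau x); last first.
      by congr (_ * _); apply: eq_bigr => i _; rewrite mxE; ring.
    rewrite [X in X @ _](_ : _ = (fun n => (\sum_i (2 * (partial i (psi n) x * partial i (phi tau) x)
        - partial i (psi n) x * partial i (psi n) x)) * P tau x)).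
      exact: cS'.
    apply/funext => n /=; rewrite /J /G mulrA -mulrBl; congr (_ * _).
    rewrite /dotmul /sqnorm mulr_sumr -sumrB; apply: eq_bigr => i _.
    by rewrite !mxE; ring.
  - move=> n x _; rewrite -!EFinM -EFinD /= lee_fin /J /G.
    have q1 := sqnorm_grad_trunc_cutoff phi2 x (a0 n) (a1 n).
    have q2 := norm_dotmul_le (grad (psi n) x) (grad (phi tau) x).
    have q3 := sqnorm_ge0 (grad (psi n) x).
    rewrite !mulrA -mulrBl -mulrDl normrM (ger0_norm (P0 x)) ler_wpM2r//.
    rewrite (le_trans (ler_normB _ _))// normrM (ger0_norm q3) ger0_norm//.
    by rewrite -/(psi n) in q1; lra.
have /fine_cvgP[_ /cvgrPdist_lt/(_ _ e0)] := cv.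
move=> [n _ /(_ n (leqnn n)) Kn0].
have Kn : `|K - fine (\int[leb d]_x (2 * J n x - G n x)%:E)%E| < e by exact: Kn0.
exists (psi n), (a n ^- 2); split; [exact: psi2|exact: psiM|].
move: Kn; rewrite ltr_distlC => /andP[/ltW Kn _]; apply: le_trans Kn _.
rewrite le_eqVlt; apply/orP; left; apply/eqP.
have -> : (fun x => (2 * J n x - G n x)%:E) = (fun x => (2%:E * (J n x)%:E - (G n x)%:E)%E).
  by apply/funext => x; rewrite -EFinM -EFinB.
have iJ2 := integrableZl measurableT 2 (iJ n).
have JE : (\int[leb d]_x (J n x)%:E = (\int[leb d]_x J n x)%:E)%E.
  by rewrite /Rintegral fineK//; exact: (integrable_fin_num measurableT (iJ n)).
have GE : (\int[leb d]_x (G n x)%:E = (\int[leb d]_x G n x)%:E)%E.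
  by rewrite /Rintegral fineK//; exact: (integrable_fin_num measurableT (iG n)).
have -> : (\int[leb d]_x (2%:E * (J n x)%:E - (G n x)%:E) =
    (2 * \int[leb d]_x J n x - \int[leb d]_x G n x)%:E)%E.
  rewrite (integralB measurableT iJ2 (iG n)) (integralZl measurableT (iJ n)).
  by rewrite [X in (_ * X - _)%E]JE [X in (_ - X)%E]GE.
by [].
Qed.

(** The test function is fixed before dt is taken small, so the bound [L] on its second-order data
    is a constant. The threshold on dt does not depend on the competing path, which allows passing
    to the infimum. *)
Lemma sq_speed_ge (e : R) : 0 < e ->
  \forall dt \near (0 : R)^', ((K - e)%:E <= sq_speed s l P tau dt)%E.
Proof.
move=> e0; have [psi [M [psi2 psiM psiK]]] := gradient_test_function (divr_gt0 e0 (ltr0Sn R 1)).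
pose g y := sqnorm (grad psi y).
have g1 : C1 g by exact: C1_sqnorm_grad.
have gM : cube_supported M g by exact: sqnorm_grad_supported psiM.
have [L HL] := continuous_cube_bounded (continuous_sqnorm_grad g1)
  (sqnorm_grad_supported gM).
pose H u := \int[leb d]_x (psi x * P u x).
pose J := \int[leb d]_x (dotmul (grad psi x) (grad (phi tau) x) * P tau x).
have dH := is_derive_pairing hPreg hPt hPtcont psi2.1 psiM htau.
have JE : J = \int[leb d]_x (psi x * derive1 (fun r => P r x) tau).
  by rewrite /J /Rintegral (pairing_velocity hPreg hphireg hphi psi2.1 psiM htau).
rewrite -JE in dH; case: dH => dH HJ.
have cH : h^-1 *: ((H \o shift tau) (h *: 1) - H tau) @[h --> (0 : R)^'] --> J.
  by rewrite -HJ; exact: dH.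
have K0 : 0 <= K.
  by rewrite -lee_fin -hK; apply: kinetic_ge0 => x; have [_ + _] := hP htau; apply.
pose q := (K / l + L * l) / 2.
have e8 : 0 < e / 8 by rewrite divr_gt0.
have n1 : \forall dt \near (0 : R)^', `|(H (tau + dt) - H tau) / dt - J| <= e / 8.
  move/cvgrPdist_le : cH => /(_ _ e8); apply: filterS => dt.
  by rewrite distrC /= [dt *: 1]mulr1 [dt + tau]addrC [dt^-1 *: _]mulrC.
near=> dt.
have dt0 : dt != 0 by near: dt; exact: nbhs_dnbhs_neq.
have D1 : `|(H (tau + dt) - H tau) / dt - J| <= e / 8 by near: dt.
have D2 : `|dt| * q <= e / 8.
  (* Adding 1 keeps the denominator positive when [q] is zero. *)
  have qn : 0 < `|q| + 1 by rewrite ltr_wpDl.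
  have : `|dt| < e / 8 / (`|q| + 1) by near: dt; apply: dnbhs0_lt; rewrite !divr_gt0.
  rewrite ltr_pdivlMr// => /ltW; apply: le_trans.
  by rewrite ler_wpM2l// (le_trans (ler_norm q))// lerDl.
have le1 : ((dt ^+ 2 * (K - e))%:E <= W2 s l (P tau) (P (tau + dt)%R) ^+ 2)%E.
  rewrite W2_sqr; apply/ereal_infP => y [v [p [vp ->]]].
  have A0 : (0 <= \int[lebesgue_measure]_(t in `[s, (s + l)%R]%classic) kinetic (v t) (p t))%E.
    apply: integral_ge0 => t Dt; apply: kinetic_ge0 => x.
    by have [_ + _] := admissible_density vp Dt; apply.
  (* Paths of infinite action satisfy the bound trivially; the real-valued estimate applies to the
     others. *)
  have [Aoo|] := ltP (\int[lebesgue_measure]_(t in `[s, (s + l)%R]%classic) kinetic (v t) (p t))%E +oo%E; last first.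
    by rewrite leye_eq => /eqP ->; rewrite gt0_muley ?lte_fin// leey.
  have Afin : (\int[lebesgue_measure]_(t in `[s, (s + l)%R]%classic) kinetic (v t) (p t))%E \is a fin_num.
    by rewrite ge0_fin_numE.
  set A := fine (\int[lebesgue_measure]_(t in `[s, (s + l)%R]%classic) kinetic (v t) (p t))%E.
  have AE : (\int[lebesgue_measure]_(t in `[s, (s + l)%R]%classic) kinetic (v t) (p t) = A%:E)%E.
    by rewrite /A fineK.
  rewrite AE -EFinM lee_fin.
  have Age0 : 0 <= A by rewrite -lee_fin -AE.
  have gL x : sqnorm (grad g x) <= L by apply: le_trans (HL x); exact: ler_norm.
  have AleA : (\int[lebesgue_measure]_(t in `[s, (s + l)%R]%classic) kinetic (v t) (p t) <= A%:E)%E.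
    by rewrite AE.
  have main := action_lower_bound l0 dt0 vp psi2 psiM gL AleA Age0.
  exact: (lower_step l0 dt0 e0 main D1 psiK D2).
rewrite /sq_speed; apply: le_trans (lee_wpmul2r _ le1); last first.
  by rewrite lee_fin invr_ge0 sqr_ge0.
by rewrite -EFinM lee_fin mulrAC mulfV ?mul1r// sqrf_eq0.
Unshelve. all: by end_near. Qed.

(** The two one-sided bounds with e = 1 show that the quotient is eventually finite; with arbitrary
    e they give convergence of its real value. *)
Lemma cvg_sq_speed : sq_speed s l P tau dt @[dt --> (0 : R)^'] --> K%:E.
Proof.
apply/fine_cvgP; split.
  near=> dt.
  have h1 : (sq_speed s l P tau dt <= (K + 1)%:E)%E by near: dt; exact: sq_speed_le.
  have h2 : ((K - 1)%:E <= sq_speed s l P tau dt)%E by near: dt; exact: sq_speed_ge.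
  by rewrite fin_numE -ltey -ltNye (lt_le_trans _ h2) ?ltNyr// (le_lt_trans h1) ?ltry.
apply/cvgrPdist_le => e e0; near=> dt.
have h1 : (sq_speed s l P tau dt <= (K + e)%:E)%E by near: dt; exact: sq_speed_le.
have h2 : ((K - e)%:E <= sq_speed s l P tau dt)%E by near: dt; exact: sq_speed_ge.
move: h1 h2 => /=; case: (sq_speed _ _ _ _ _) => [x| |]//.
by rewrite !lee_fin /= ler_distlC => -> ->.
Unshelve. all: by end_near. Qed.

End limit.

(** Convergence is part of the conclusion because [lim] is a total operator: the formula for the
    excess rate is meaningful as a limit only together with it. The interval [s, s + l]
    parametrizing the paths in [W2] is arbitrary. *)
Theorem theorem12 (R : realType) (d : nat) (mu T : R)
  (hmu : 0 < mu) (hT : 0 < T)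
  (t0 t1 tau : R) (htau : tau \in `]t0, t1[)
  (s l : R) (hl : 0 < l)
  (F : R -> 'rV[R]_d -> 'rV[R]_d)
  (P phi : R -> 'rV[R]_d -> R)
  (hP : forall t, t \in `]t0, t1[ ->
     [/\ density (P t), (forall x, 0 < P t x) & finite_second_moment (P t)])
  (hPreg : forall t, t \in `]t0, t1[ -> C2 (P t))
  (hFreg : forall t, t \in `]t0, t1[ -> C1_field (F t))
  (hphireg : forall t, t \in `]t0, t1[ -> C2 (phi t))
  (hPt : forall t x, t \in `]t0, t1[ -> derivable (fun r => P r x) t 1)
  (hPtcont : forall t x, t \in `]t0, t1[ ->
     {for (t, x), continuous (fun z : R * 'rV[R]_d =>
        derive1 (fun r => P r z.2) z.1)})
  (hgradcont : forall t x, t \in `]t0, t1[ ->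
     {for (t, x), continuous (fun z : R * 'rV[R]_d => grad (phi z.1) z.2)})
  (hFP : forall t x, t \in `]t0, t1[ ->
     derive1 (fun r => P r x) t =
     - div (fun y => P t y *: mean_local_velocity mu T F P t y) x)
  (hphi : forall t x, t \in `]t0, t1[ ->
     derive1 (fun r => P r x) t = - div (fun y => P t y *: grad (phi t) y) x)
  (hkin : {for tau, continuous (fun t => kinetic (grad (phi t)) (P t))})
  (hsigma : (entropy_production_rate mu T (mean_local_velocity mu T F P) P tau
             < +oo)%E)
  (hdecay : vanishing_boundary_term (fun x => (phi tau x * P tau x) *:
     (mean_local_velocity mu T F P tau x - grad (phi tau) x))) :
  [/\ cvg (sq_speed s l P tau dt @[dt --> (0 : R)^']),
      excess_rate s l mu T P tau =
        ((mu * T)^-1%:E * \int[leb d]_x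
           (sqnorm (grad (phi tau) x) * P tau x)%:E)%E &
      housekeeping_rate s l mu T (mean_local_velocity mu T F P) P tau =
        ((mu * T)^-1%:E * \int[leb d]_x
           (sqnorm (mean_local_velocity mu T F P tau x - grad (phi tau) x)
            * P tau x)%:E)%E].
Proof.
have [Pd P0 _] := hP tau htau.
have hP' t : t \in `]t0, t1[ -> density (P t) by move=> /hP[].
have hP1 t : t \in `]t0, t1[ -> C1 (P t) by move=> /hPreg[].
have muT0 : 0 < (mu * T)^-1 by rewrite invr_gt0 mulr_gt0.
have same_div x : div (fun y => P tau y *: mean_local_velocity mu T F P tau y) x =
    div (fun y => P tau y *: grad (phi tau) y) x.
  by apply: oppr_inj; rewrite -hFP// hphi.
have [K [Kw [KE KwE KnuE]]] := kinetic_decomposition muT0 P0 (hPreg tau htau)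
  (hFreg tau htau) (hphireg tau htau) same_div hsigma hdecay.
have cv := cvg_sq_speed hP' hP1 hphireg hPt hPtcont hgradcont hphi s hl htau hkin KE.
have limE : excess_rate s l mu T P tau = ((mu * T)^-1%:E * K%:E)%E.
  by rewrite /excess_rate; congr (_ * _)%E; exact: cvg_lim cv.
split.
- by apply/cvg_ex; exists K%:E; exact: cv.
- by rewrite limE -KE.
- rewrite /housekeeping_rate limE /entropy_production_rate KnuE -/(kinetic _ _) KwE.
  by rewrite -!EFinM -EFinB; congr EFin; ring.
Qed.
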